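(* Let $\delta=\delta(n)>0$ be such that $\delta^2 n\to\infty$ (arbitrarily slowly) as $n\to\infty$. Then the censored Glauber dynamics for the mean-field Ising model on $n$ vertices with parameter $\beta=1+\delta$ has a spectral gap of order $\delta/n$; that is, its spectral gap is $\Theta(\delta/n)$ as $n\to\infty$.
   Context: Mean-field (Curie-Weiss) Ising model: configurations are $\sigma\in\Omega=\{1,-1\}^n$, with Gibbs measure $\mu_n(\sigma)\propto\exp\big(\frac{\beta}{n}\sum_{x<y}\sigma(x)\sigma(y)\big)$. Heat-bath Glauber dynamics $(X_t)$: at each step a site $i$ is chosen uniformly at random and its spin is resampled from $\mu_n$ conditioned on all other spins; i.e. from state $\sigma$ the new spin of $i$ is $+1$ with probability $p^+(S(\sigma)-\sigma(i)/n)$ and $-1$ otherwise, where $p^+(s)=\frac{1+\tanh(\beta s)}{2}$ and $S(\sigma)=\frac1n\sum_j\sigma(j)$. Censored Glauber dynamics $(\mathcal X_t)$: the Markov chain on $\{\sigma\in\Omega:\sum_i\sigma(i)\ge 0\}$ which at each step generates a new state $\sigma$ by the rule of the Glauber dynamics and, if $\sum_i\sigma(i)<0$, replaces $\sigma$ by $-\sigma$. The spectral gap of a chain is $1-\lambda$, where $\lambda$ is the largest absolute value of all nontrivial eigenvalues of the transition kernel (those other than the trivial eigenvalue $1$).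
   Formalization: The sequence δ(n) is additionally assumed bounded; without this the claim is false (for δ = n² the gap is at most 1 while δ/n = n), and since the gap is always O(1/n), Θ(δ/n) already forces δ to be bounded. *)

(* Defs.v *)
From HB Require Import structures.
From mathcomp Require Import all_boot all_order all_algebra.
From mathcomp Require Import all_classical all_reals all_analysis.
From mathcomp Require Import complex ring lra.

Set Implicit Arguments.
Unset Strict Implicit.
Unset Printing Implicit Defensive.

Import Order.TTheory GRing.Theory Num.Theory.
Import numFieldNormedType.Exports.

Local Open Scope classical_set_scope.
Local Open Scope ring_scope.

(* [true] stands for the spin +1 and [false] for the spin -1. *)
Definition config (n : nat) := {ffun 'I_n -> bool}.

Definition spin (b : bool) : int := if b then 1 else -1.

Definition total_spin (n : nat) (x : config n) : int := \sum_(i < n) spin (x i).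

Definition flip (n : nat) (x : config n) : config n := [ffun i => ~~ x i].

Definition set_spin (n : nat) (x : config n) (i : 'I_n) (b : bool) : config n :=
  [ffun j => if j == i then b else x j].

Definition gibbs_weight (R : realType) (n : nat) (beta : R) (x : config n) : R :=
  expR (beta / n%:R *
        \sum_(i < n) \sum_(j < n | (i < j)%N) (spin (x i) * spin (x j))%:~R).

Definition gibbs (R : realType) (n : nat) (beta : R) (x : config n) : R :=
  gibbs_weight beta x / \sum_(y : config n) gibbs_weight beta y.

(* The conditional probability under the Gibbs measure that site [i] has spin
   [b], given that the spins at all the other sites are those of [x]. *)
Definition heat_bath (R : realType) (n : nat) (beta : R) (x : config n)
    (i : 'I_n) (b : bool) : R :=
  gibbs beta (set_spin x i b) / \sum_(c : bool) gibbs beta (set_spin x i c).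

Definition glauber (R : realType) (n : nat) (beta : R) (x y : config n) : R :=
  n%:R^-1 * \sum_(i < n) \sum_(b : bool | set_spin x i b == y)
    heat_bath beta x i b.

Definition censored_state (n : nat) := {x : config n | 0 <= total_spin x}.

Definition censor (n : nat) (x : config n) : config n :=
  if total_spin x < 0 then flip x else x.

Definition censored_glauber (R : realType) (n : nat) (beta : R)
    (x y : censored_state n) : R :=
  \sum_(z : config n | censor z == val y) glauber beta (val x) z.

(* Complex eigenvalues, since a transition kernel need not be reversible; the
   censored dynamics is not when [n >= 4] is even, as a state [x] of total spin
   0 can move to neighbours of [flip x], none of which can move back to [x].
   [eigenvalue] refers to row vectors, which gives the same spectrum as the
   action of [P] on functions. *)
Definition kernel_matrix (R : realType) (T : finType) (P : T -> T -> R) :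
    'M[R[i]]_#|T| :=
  \matrix_(i, j) (P (enum_val i) (enum_val j))%:C%C.

(* The spectrum is finite, so [sup] is a maximum as soon as there is a nontrivial
   eigenvalue; otherwise it is 0. *)
Definition spectral_gap (R : realType) (T : finType) (P : T -> T -> R) : R :=
  1 - sup [set complex.Re `|z| | z in
            [set z : R[i] | eigenvalue (kernel_matrix P) z /\ z != 1]].

Definition tanh (R : realType) (s : R) : R :=
  (expR s - expR (- s)) / (expR s + expR (- s)).

Definition p_plus (R : realType) (beta s : R) : R := (1 + tanh (beta * s)) / 2.

Definition mean_spin (R : realType) (n : nat) (x : config n) : R :=
  (total_spin x)%:~R / n%:R.

Lemma gibbs_weight_set_spin (R : realType) (n : nat) (beta : R) (x : config n)
    (i : 'I_n) :
  exists2 K : R, 0 < K & forall b, gibbs_weight beta (set_spin x i b) =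
  K * expR ((spin b)%:~R * (beta * (mean_spin R x - (spin (x i))%:~R / n%:R))).
Proof.
pose s j : R := (spin (x j))%:~R.
pose A : R := \sum_(j < n | j != i) \sum_(k < n | (j < k)%N && (k != i)) s j * s k.
exists (expR (beta / n%:R * A)); first exact: expR_gt0.
move=> b; rewrite /gibbs_weight -expRD; congr expR.
have -> : mean_spin R x - (spin (x i))%:~R / n%:R
          = (\sum_(j < n | j != i) s j) / n%:R.
  rewrite /mean_spin /total_spin -mulrBl; congr (_ / _).
  by rewrite (bigD1 i) //= rmorphD /= addrAC subrr add0r rmorph_sum.
rewrite (bigD1 i) //=.
have -> : \sum_(j < n | (i < j)%N)
    (spin (set_spin x i b i) * spin (set_spin x i b j))%:~R
    = (spin b)%:~R * \sum_(j < n | (i < j)%N) s j :> R.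
  rewrite mulr_sumr; apply: eq_bigr => j ij; rewrite !ffunE eqxx.
  by rewrite (gtn_eqF ij : (j == i) = false) rmorphM.
have -> : \sum_(j < n | j != i) \sum_(k < n | (j < k)%N)
    (spin (set_spin x i b j) * spin (set_spin x i b k))%:~R
    = A + (spin b)%:~R * \sum_(j < n | (j < i)%N) s j :> R.
  have -> : \sum_(j < n | (j < i)%N) s j
          = \sum_(j < n | j != i) (if (j < i)%N then s j else 0).
    rewrite -big_mkcondr; apply: eq_bigl => j.
    by case: ltnP => // ji; rewrite ?andbF // andbT neq_ltn ji.
  rewrite mulr_sumr -big_split /=; apply: eq_bigr => j ji.
  case: ifPn => [lt|nlt].
    rewrite (bigD1 i) //= addrC; congr (_ + _).
      apply: eq_bigr => k /andP[_ ki].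
      by rewrite !ffunE (negbTE ji) (negbTE ki) rmorphM.
    by rewrite !ffunE eqxx (negbTE ji) rmorphM mulrC.
  rewrite mulr0 addr0; apply: eq_big => [k|k jk].
    by case: eqVneq => [->|]; rewrite ?andbT // andbF (negbTE nlt).
  have ki : k != i by apply: contraNneq nlt => <-.
  by rewrite !ffunE (negbTE ji) (negbTE ki) rmorphM.
have -> : \sum_(j < n | j != i) s j
   = \sum_(j < n | (i < j)%N) s j + \sum_(j < n | (j < i)%N) s j.
  rewrite (bigID (fun j : 'I_n => (i < j)%N)) /=; congr (_ + _);
    apply: eq_bigl => j; rewrite -(inj_eq val_inj) /=; by case: ltngtP.
ring.
Qed.

Lemma heat_bathE (R : realType) (n : nat) (beta : R) (x : config n) (i : 'I_n) :
  let p := p_plus beta (mean_spin R x - (spin (x i))%:~R / n%:R) in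
  heat_bath beta x i true = p /\ heat_bath beta x i false = 1 - p.
Proof.
move=> p; rewrite /p /p_plus /tanh /heat_bath /gibbs !big_bool /=.
have [K K0 E] := gibbs_weight_set_spin beta x i.
set Z := \sum_(y : config n) _.
have Z0 : Z != 0.
  rewrite gt_eqF // /Z (bigD1 x) //= ltr_pwDl ?expR_gt0 //.
  by apply: sumr_ge0 => y _; exact: expR_ge0.
rewrite !E /spin mul1r mulN1r.
set u := beta * _.
have u0 := expR_gt0 u; have v0 := expR_gt0 (- u).
have uv : expR u + expR (- u) != 0 by rewrite gt_eqF // addr_gt0.
have K1 : K != 0 by rewrite gt_eqF.
by split; field; rewrite ?uv ?Z0 ?K1 // -?mulrDr ?mulf_neq0.
Qed.

(* Main.v *)
Require Import Defs.
From HB Require Import structures.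
From mathcomp Require Import all_boot all_order all_algebra.
From mathcomp Require Import all_fingroup.
From mathcomp Require Import all_classical all_reals all_analysis.
From mathcomp Require Import complex ring lra zify.

(* Reduction.  Away from total spin 0 the censored chain is the quotient of the Glauber
   dynamics by the global flip, so an eigenvalue of the censored chain is either an
   eigenvalue of the Glauber dynamics on even functions, hence real and nonnegative
   because every heat-bath update is a projection, or the probability (at most 1/2)
   of staying put in a state of total spin 0.

   Lower bound on the gap.  If an eigenfunction [F] is not invariant under some transposition
   of the sites, looking at the maximum of the antisymmetric part of [F] shows that its
   eigenvalue is at most [1 - 1/n].  Otherwise [F] depends on the total spin [k] only, and
   being even with mean 0 it takes both signs.  Split at a lattice point [c] next to the
   stable zero of the drift: [F] or [-F] is negative somewhere in [|k| < c] or in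
   [|k| > c] while being nonnegative at [|k| = c], and the maximum principle bounds the
   eigenvalue by [1 - eps] as soon as the region carries a positive function [psi],
   vanishing at [c], with generator at most [- eps * psi].  On the outer side
   [psi = |k| - c] works, on the inner side [1 / (k^2 + a)] with [a] of order [n / delta]
   continued linearly near [c].  The drift is controlled by the concavity of
   [X |-> sinh X / (cosh X + exp (2 beta / n))].

   Upper bound on the gap.  Near the unstable point [k = 0] the drift is at most
   [delta * |k| / n], so a bump of width [W = sqrt (n / delta)] is a subsolution
   with rate of order [1 / W^2 = delta / n].  A mean-zero combination of two even
   bumps with disjoint supports has Rayleigh quotient [1 - O(delta / n)]. *)

Set Implicit Arguments.
Unset Strict Implicit.
Unset Printing Implicit Defensive.

Import Order.TTheory GRing.Theory Num.Theory.
Import numFieldNormedType.Exports.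

Local Open Scope classical_set_scope.
Local Open Scope ring_scope.

(** * The Glauber operator and its symmetries *)

Section GlauberOperator.
Variables (R : realType) (n : nat) (beta : R).
Implicit Types (x y : config n) (i : 'I_n) (b : bool) (F U V : config n -> R).

Definition site_mean F i x : R :=
  \sum_(b : bool) heat_bath beta x i b * F (set_spin x i b).

Definition glauber_op F x : R := n%:R^-1 * \sum_(i < n) site_mean F i x.

Lemma set_spinK x i b c : set_spin (set_spin x i b) i c = set_spin x i c.
Proof. by apply/ffunP => j; rewrite !ffunE; case: eqP. Qed.

Lemma set_spin_same x i : set_spin x i (x i) = x.
Proof. by apply/ffunP => j; rewrite !ffunE; case: eqP => // ->. Qed.

Lemma gibbs_weight_gt0 x : 0 < gibbs_weight beta x.
Proof. exact: expR_gt0. Qed.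

Definition site_weight i x : R :=
  gibbs_weight beta (set_spin x i true) + gibbs_weight beta (set_spin x i false).

Lemma site_weight_gt0 i x : 0 < site_weight i x.
Proof. by rewrite addr_gt0 ?gibbs_weight_gt0. Qed.

Lemma heat_bath_weight x i b :
  heat_bath beta x i b = gibbs_weight beta (set_spin x i b) / site_weight i x.
Proof.
rewrite /heat_bath /gibbs big_bool /= -mulrDl -/(site_weight i x).
set Z := \sum_(y : config n) _.
have Z0 : Z != 0.
  rewrite gt_eqF // /Z (bigD1 x) //= ltr_pwDl ?expR_gt0 //.
  by apply: sumr_ge0 => y _; exact: expR_ge0.
have S0 : site_weight i x != 0 by rewrite gt_eqF ?site_weight_gt0.
by field; rewrite Z0 S0.
Qed.

Lemma heat_bath_gt0 x i b : 0 < heat_bath beta x i b.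
Proof. by rewrite heat_bath_weight divr_gt0 ?gibbs_weight_gt0 ?site_weight_gt0. Qed.

Lemma norm_heat_bath x i b : `|heat_bath beta x i b| = heat_bath beta x i b.
Proof. exact/gtr0_norm/heat_bath_gt0. Qed.

Lemma heat_bath_sum x i : heat_bath beta x i true + heat_bath beta x i false = 1.
Proof.
by rewrite !heat_bath_weight -mulrDl -/(site_weight i x) divff // gt_eqF ?site_weight_gt0.
Qed.

Lemma heat_bath_set_spin x i b c :
  heat_bath beta (set_spin x i c) i b = heat_bath beta x i b.
Proof. by rewrite /heat_bath !big_bool !set_spinK. Qed.

Lemma site_mean_set_spin F x i b : site_mean F i (set_spin x i b) = site_mean F i x.
Proof. by apply: eq_bigr => c _; rewrite heat_bath_set_spin set_spinK. Qed.

(** Resampling site [i] reaches each configuration twice, from itself and from the one that differs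
    from it at [i] only; hence the factor [2^-1]. *)
Lemma sum_set_spin i (g : config n -> R) :
  \sum_x g x = 2^-1 * \sum_x \sum_(b : bool) g (set_spin x i b).
Proof.
have flipK : involutive (fun x : config n => set_spin x i (~~ x i)).
  by move=> x; rewrite set_spinK !ffunE eqxx negbK set_spin_same.
have -> : \sum_x \sum_(b : bool) g (set_spin x i b)
    = \sum_x (g x + g (set_spin x i (~~ x i))).
  apply: eq_bigr => x _; rewrite big_bool -[X in X + _](congr1 g (set_spin_same x i)).
  by case: (x i) => //=; rewrite addrC.
have E : \sum_x g (set_spin x i (~~ x i)) = \sum_x g x.
  by rewrite [RHS](reindex_inj (inv_inj flipK)).
rewrite big_split /= E.
by rewrite -mulr2n -[X in _ * X]mulr_natl mulrA mulVf ?mul1r ?pnatr_eq0.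
Qed.

(** The update at [i] is the conditional expectation given the other spins, so it is an orthogonal
    projection for the Gibbs weight. Putting the projection on both arguments makes symmetry and
    nonnegativity of the form visible. *)
Lemma site_mean_form U V i :
  \sum_x gibbs_weight beta x * U x * site_mean V i x
  = 2^-1 * \sum_x site_weight i x * (site_mean U i x * site_mean V i x).
Proof.
rewrite (sum_set_spin i); congr (_ * _); apply: eq_bigr => x _.
under eq_bigr do rewrite site_mean_set_spin.
rewrite -mulr_suml mulrA; congr (_ * _); rewrite /site_mean mulr_sumr.
apply: eq_bigr => b _; rewrite heat_bath_weight mulrA; congr (_ * _).
by rewrite mulrC divfK // gt_eqF ?site_weight_gt0.
Qed.

Lemma glauber_op_form U V :
  \sum_x gibbs_weight beta x * U x * glauber_op V x
  = n%:R^-1 * \sum_(i < n) (2^-1 *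
     \sum_x site_weight i x * (site_mean U i x * site_mean V i x)).
Proof.
under [in RHS]eq_bigr do rewrite -site_mean_form.
rewrite exchange_big mulr_sumr; apply: eq_bigr => x _.
by rewrite -mulr_sumr mulrCA.
Qed.

Lemma glauber_op_sym U V :
  \sum_x gibbs_weight beta x * U x * glauber_op V x
  = \sum_x gibbs_weight beta x * V x * glauber_op U x.
Proof.
rewrite !glauber_op_form; congr (_ * _); apply: eq_bigr => i _; congr (_ * _).
by apply: eq_bigr => x _; congr (_ * _); rewrite mulrC.
Qed.

Lemma glauber_op_ge0 U :
  0 <= \sum_x gibbs_weight beta x * U x * glauber_op U x.
Proof.
rewrite glauber_op_form mulr_ge0 ?invr_ge0 ?ler0n //.
apply: sumr_ge0 => i _; rewrite mulr_ge0 ?invr_ge0 //.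
apply: sumr_ge0 => x _; rewrite mulr_ge0 ?(ltW (site_weight_gt0 _ _)) //.
by rewrite -expr2 sqr_ge0.
Qed.

Lemma glauber_sumE x (h : config n -> R) :
  \sum_z glauber beta x z * h z = glauber_op h x.
Proof.
rewrite /glauber /glauber_op.
under eq_bigr do rewrite -mulrA mulr_suml.
rewrite -mulr_sumr; congr (_ * _); rewrite exchange_big; apply: eq_bigr => i _ /=.
under eq_bigr do rewrite mulr_suml; rewrite /site_mean.
rewrite (exchange_big_dep predT) //=; apply: eq_bigr => b _.
by rewrite (big_pred1 (set_spin x i b)) // => z; rewrite /= eq_sym.
Qed.

Lemma glauber_opD U V x : glauber_op (fun y => U y + V y) x = glauber_op U x +
  glauber_op V x.
Proof.
rewrite -!glauber_sumE -big_split; apply: eq_bigr => z _; exact: mulrDr.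
Qed.

Lemma glauber_opZ a U x : glauber_op (fun y => a * U y) x = a * glauber_op U x.
Proof.
rewrite -!glauber_sumE mulr_sumr; apply: eq_bigr => z _; exact: mulrCA.
Qed.

Lemma eq_glauber_op U V : U =1 V -> glauber_op U =1 glauber_op V.
Proof.
move=> UV x; rewrite -!glauber_sumE; apply: eq_bigr => z _; by rewrite UV.
Qed.

Hypothesis n_gt0 : (0 < n)%N.

Lemma glauber_op_cst a x : glauber_op (fun=> a) x = a.
Proof.
rewrite /glauber_op (eq_bigr (fun=> a)) => [|i _].
  rewrite sumr_const card_ord -[a *+ n]mulr_natl mulrA mulVf ?mul1r //.
  by rewrite pnatr_eq0 -lt0n.
by rewrite /site_mean big_bool /= -mulrDl heat_bath_sum mul1r.
Qed.

Lemma sum_glauber_op F :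
  \sum_x gibbs_weight beta x * glauber_op F x = \sum_x gibbs_weight beta x * F x.
Proof.
have := glauber_op_sym (fun=> 1) F; under eq_bigr do rewrite mulr1.
by move=> ->; apply: eq_bigr => x _; rewrite glauber_op_cst mulr1.
Qed.

(** The Gibbs measure is stationary, so averaging the eigenvalue equation multiplies the mean by [z]
    without changing it. *)
Lemma eigen_mean0 F z : z != 1 -> (forall x, glauber_op F x = z * F x) ->
  \sum_x gibbs_weight beta x * F x = 0.
Proof.
move=> z1 GF; have := sum_glauber_op F.
under eq_bigr do rewrite GF mulrCA; rewrite -mulr_sumr => /eqP.
rewrite -subr_eq0 -{2}[\sum_x _]mul1r -mulrBl mulf_eq0 subr_eq0 (negbTE z1) /=.
by move/eqP.
Qed.

End GlauberOperator.

(** * The heat-bath probability as a logistic function *)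

Section Logistic.
Variables (R : realType) (beta : R).
Implicit Types s t : R.

Lemma p_plus_logistic s : p_plus beta s = expR (2 * (beta * s)) / (1 + expR (2 * (beta *
  s))).
Proof.
rewrite /p_plus /tanh.
have -> : 2 * (beta * s) = beta * s + beta * s by rewrite mulr_natl mulr2n.
rewrite expRD expRN.
have e0 := expR_gt0 (beta * s); set e := expR _ in e0 *.
have e2 : 1 + e * e != 0 by rewrite gt_eqF // ltr_pwDl // mulr_ge0 // ltW.
have e1 : e != 0 by rewrite gt_eqF.
have e3 : e + e^-1 != 0 by rewrite gt_eqF // addr_gt0 // invr_gt0.
by field; rewrite e1 e2.
Qed.

Lemma p_plusN s : p_plus beta (- s) = 1 - p_plus beta s.
Proof.
rewrite !p_plus_logistic !mulrN expRN.
have e0 := expR_gt0 (2 * (beta * s)); set e := expR _ in e0 *.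
have e2 : 1 + e != 0 by rewrite gt_eqF // addr_gt0.
have e1 : e != 0 by rewrite gt_eqF.
have e3 : 1 + e^-1 != 0 by rewrite gt_eqF // addr_gt0 // invr_gt0.
by field; rewrite ?e1 ?e2 ?(addrC e) ?e2.
Qed.

Lemma p_plus_gt0 s : 0 < p_plus beta s.
Proof.
by rewrite p_plus_logistic divr_gt0 ?expR_gt0 // addr_gt0 ?expR_gt0.
Qed.

Lemma p_plus_lt1 s : p_plus beta s < 1.
Proof. by have := p_plus_gt0 (- s); rewrite p_plusN; lra. Qed.

Hypothesis beta_ge0 : 0 <= beta.

Lemma p_plus_homo s t : s <= t -> p_plus beta s <= p_plus beta t.
Proof.
move=> st; rewrite !p_plus_logistic.
have ee : expR (2 * (beta * s)) <= expR (2 * (beta * t)).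
  by rewrite ler_expR ler_wpM2l // ler_wpM2l.
have a0 := expR_gt0 (2 * (beta * s)); have b0 := expR_gt0 (2 * (beta * t)).
rewrite ler_pdivrMr ?addr_gt0 // mulrAC ler_pdivlMr ?addr_gt0 //.
by lra.
Qed.

End Logistic.

(** * Global flip and permutations of the sites *)

Section Symmetries.
Variables (R : realType) (n : nat) (beta : R).
Implicit Types (x y : config n) (i : 'I_n) (b : bool) (F : config n -> R).

Lemma flipK x : flip (flip x) = x.
Proof. by apply/ffunP => i; rewrite !ffunE negbK. Qed.

Lemma total_spin_flip x : total_spin (flip x) = - total_spin x.
Proof.
rewrite /total_spin -sumrN; apply: eq_bigr => i _.
by rewrite ffunE /spin; case: (x i).
Qed.

Lemma set_spin_flip x i b : set_spin (flip x) i b = flip (set_spin x i (~~ b)).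
Proof. by apply/ffunP => j; rewrite !ffunE; case: eqP; rewrite ?negbK. Qed.

Lemma gibbs_weight_flip x : gibbs_weight beta (flip x) = gibbs_weight beta x.
Proof.
rewrite /gibbs_weight; congr (expR (_ * _)).
apply: eq_bigr => i _; apply: eq_bigr => j _; congr (_%:~R).
by rewrite !ffunE /spin; case: (x i); case: (x j).
Qed.

Lemma site_mean_flip F i x :
  site_mean beta F i (flip x) = site_mean beta (F \o @flip n) i x.
Proof.
rewrite /site_mean !big_bool /= addrC !heat_bath_weight /site_weight.
rewrite !set_spin_flip !gibbs_weight_flip /=.
set a := gibbs_weight beta (set_spin x i true).
by set b := gibbs_weight beta (set_spin x i false); rewrite [b + a]addrC.
Qed.

Lemma glauber_op_flip F x : glauber_op beta F (flip x) = glauber_op beta (F \o @flip n) x.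
Proof.
by rewrite /glauber_op; congr (_ * _); apply: eq_bigr => i _; rewrite site_mean_flip.
Qed.

Definition perm_config (s : 'S_n) x : config n := [ffun k => x (s k)].

Lemma total_spin_perm s x : total_spin (perm_config s x) = total_spin x.
Proof.
rewrite /total_spin [RHS](reindex_inj (@perm_inj _ s)) /=.
by apply: eq_bigr => i _; rewrite ffunE.
Qed.

Lemma set_spin_perm s x i b :
  set_spin (perm_config s x) i b = perm_config s (set_spin x (s i) b).
Proof.
by apply/ffunP => j; rewrite !ffunE (inj_eq perm_inj).
Qed.

Lemma heat_bath_perm s x i b :
  heat_bath beta (perm_config s x) i b = heat_bath beta x (s i) b.
Proof.
have [h1 h2] := heat_bathE beta (perm_config s x) i.
have [k1 k2] := heat_bathE beta x (s i).
by case: b; rewrite ?h1 ?h2 ?k1 ?k2 /mean_spin total_spin_perm ffunE.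
Qed.

Lemma glauber_op_perm F s x :
  glauber_op beta F (perm_config s x) = glauber_op beta (F \o perm_config s) x.
Proof.
rewrite /glauber_op; congr (_ * _).
rewrite [RHS](reindex_inj (@perm_inj _ s)) /=; apply: eq_bigr => i _.
by apply: eq_bigr => b _; rewrite heat_bath_perm set_spin_perm.
Qed.

Hypothesis beta_ge0 : 0 <= beta.

(** Where the modulus of [H] is largest, the spins at [i] and [j] differ, since [H] vanishes where
    they agree. An update that changes one of these two spins makes them agree, so only the
    probabilities of keeping them contribute, and these add up to at most 1. Each of the other
    [n - 2] sites contributes at most the maximum. *)
Lemma antisymmetric_eigenvalue (H : config n -> R) (z : R) (i j : 'I_n) :
  i != j -> (forall x, H (perm_config (tperm i j) x) = - H x) ->
  (forall x, glauber_op beta H x = z * H x) -> (exists x, H x != 0) ->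
  `|z| <= 1 - n%:R^-1.
Proof.
move=> ij Hanti GH [x0 Hx0].
have n0 : (0 < n)%N by exact: leq_ltn_trans (leq0n i) (ltn_ord i).
have [x _ xmax] := arg_maxP (fun x => `|H x|) (erefl true : xpredT x0).
have {}xmax y : `|H y| <= `|H x| by exact: xmax.
have Hx : 0 < `|H x| by rewrite (lt_le_trans _ (xmax x0)) // normr_gt0.
have H0 y : y i = y j -> H y = 0.
  move=> yij; have := Hanti y.
  have -> : perm_config (tperm i j) y = y.
    by apply/ffunP => k; rewrite ffunE; case: tpermP => [->|->|].
  by lra.
wlog xi : x xmax Hx / x i.
  move=> th; case xi : (x i); first exact: (th x).
  have xj : x j.
    apply: contraTT Hx => xj; rewrite H0 ?normr0 ?ltxx //.
    by rewrite xi (negbTE xj).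
  have E : `|H (perm_config (tperm i j) x)| = `|H x| by rewrite Hanti normrN.
  by apply: (th (perm_config (tperm i j) x)); rewrite ?E // ffunE tpermL.
have xj : x j = false.
  by apply: contraTF Hx => xj; rewrite H0 ?normr0 ?ltxx // xi xj.
have step l : `|site_mean beta H l x| <= `|H x|.
  rewrite /site_mean big_bool /=; apply: (le_trans (ler_normD _ _)).
  rewrite !(normrM (heat_bath _ _ _ _)) !norm_heat_bath.
  rewrite -[leRHS]mul1r -(heat_bath_sum beta x l) mulrDl.
  by rewrite lerD // ler_wpM2l ?xmax // ltW ?heat_bath_gt0.
have stepi : site_mean beta H i x = heat_bath beta x i true * H x.
  rewrite /site_mean big_bool /= [X in _ + _ * X]H0 ?mulr0 ?addr0.
    by rewrite -{2}xi set_spin_same.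
  by rewrite !ffunE eqxx eq_sym (negbTE ij) xj.
have stepj : site_mean beta H j x = heat_bath beta x j false * H x.
  rewrite /site_mean big_bool /= [X in _ * X + _]H0 ?mulr0 ?add0r.
    by rewrite -{2}xj set_spin_same.
  by rewrite !ffunE eqxx (negbTE ij) xi.
(* Leaving out its own spin, the plus spin at [i] feels a mean spin lower by [2 / n] than the minus
   spin at [j], and [p_plus] is monotone. *)
have stay : heat_bath beta x i true + heat_bath beta x j false <= 1.
  have [-> _] := heat_bathE beta x i; have [_ ->] := heat_bathE beta x j.
  rewrite xi xj /spin rmorphN /= addrCA gerDl subr_le0 mulNr opprK.
  apply: p_plus_homo => //; rewrite lerD2l mul1r.
  by rewrite (@le_trans _ _ 0) // ?oppr_le0 invr_ge0.
have bound : `|z| * `|H x| <= n%:R^-1 * ((n%:R - 1) * `|H x|).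
  rewrite -normrM -GH /glauber_op normrM ger0_norm ?invr_ge0 //.
  rewrite ler_wpM2l ?invr_ge0 // (le_trans (ler_norm_sum _ _ _)) //.
  rewrite (bigD1 i) //= (bigD1 j) 1?eq_sym //= stepi stepj !(normrM (heat_bath _ _ _ _)).
  rewrite !norm_heat_bath addrA -mulrDl.
  have -> : n%:R - 1 = 1 + (n%:R - 2) :> R by ring.
  rewrite [leRHS]mulrDl; apply: lerD; first by rewrite ler_wpM2r.
  apply: (le_trans (ler_sum _ (fun l _ => step l))).
  rewrite sumr_const -[leLHS]mulr_natl ler_wpM2r //.
  have := cardC (pred2 i j); rewrite card_ord card2 ij => /(congr1 (fun m => m%:R : R)).
  rewrite natrD /= => cardn.
  have -> : #|[pred l | (l != i) && (l != j)]| = #|[predC pred2 i j]|.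
    by apply: eq_card => l; rewrite !inE negb_or.
  by rewrite lerBrDl cardn.
rewrite -(ler_pM2r Hx) (le_trans bound) // mulrA ler_wpM2r //.
by rewrite mulrBr mulVf ?mulr1 // pnatr_eq0 -lt0n.
Qed.

Lemma total_spinE x : total_spin x = #|[pred i | x i]|%:Z *+ 2 - n%:Z.
Proof.
rewrite /total_spin (eq_bigr (fun i => (if x i then 1 else 0) *+ 2 - 1)).
  rewrite sumrB sumrMnl sumr_const card_ord natz -big_mkcond sumr_const.
  by rewrite natz.
by move=> i _; rewrite /spin; case: (x i).
Qed.

(** Induction on the number of sites where [x] and [y] disagree: equal total spins provide one
    disagreement of each sign, and swapping these two sites removes both. *)
Lemma tperm_invariant_total_spin F :
  (forall i j x, F (perm_config (tperm i j) x) = F x) ->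
  forall x y, total_spin x = total_spin y -> F x = F y.
Proof.
move=> Finv x y; have [m] := ubnP #|[pred i | x i != y i]|.
elim: m x => // m IH x /ltnSE dm xy.
have [->//|neq] := eqVneq x y.
have cardE : #|[pred i | x i]| = #|[pred i | y i]|.
  by move: xy; rewrite !total_spinE; lia.
have half (a b : config n) : a != b -> #|[pred i | a i]| = #|[pred i | b i]| ->
    exists i, a i && ~~ b i.
  move=> nab cab; apply/existsP; apply: contraNT nab.
  rewrite negb_exists => /forallP sub; apply/eqP/ffunP => k.
  have /(subset_cardP cab)/(_ k) : [pred i | a i] \subset [pred i | b i].
    by apply/fintype.subsetP => l; rewrite !inE => al; have := sub l; rewrite al /= negbK.
  by rewrite !inE.
have neq' : y != x by rewrite eq_sym.
have [i /andP[xi yi]] := half x y neq cardE.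
have [j /andP[yj xj]] := half y x neq' (esym cardE).
rewrite -(Finv i j x); apply: IH; last by rewrite total_spin_perm.
apply: leq_trans dm; apply: proper_card; apply/fintype.properP; split.
  apply/fintype.subsetP => k; rewrite !inE ffunE; case: tpermP => [->|->|//].
    by rewrite (negbTE xj) (negbTE yi).
  by rewrite xi yj.
exists i; rewrite !inE; first by rewrite xi (negbTE yi).
by rewrite ffunE tpermL (negbTE xj) (negbTE yi).
Qed.

(** The antisymmetric part of [F] under a transposition solves the same eigenvalue equation, and [z]
    is too large for it unless it vanishes. *)
Lemma total_spin_invariant_eigenfunction F (z : R) :
  (forall x, glauber_op beta F x = z * F x) -> 1 - n%:R^-1 < `|z| ->
  forall x y, total_spin x = total_spin y -> F x = F y.
Proof.
move=> GF zlt; apply: tperm_invariant_total_spin => i j x.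
have [<-|ij] := eqVneq i j; first by congr F; rewrite tperm1; apply/ffunP => k;
  rewrite ffunE perm1.
pose H y := F y + (-1) * F (perm_config (tperm i j) y).
have Hx : H x = 0.
  apply/eqP; apply: contraTT zlt => Hx; rewrite -leNgt.
  apply: (@antisymmetric_eigenvalue H z i j ij); last by exists x.
    move=> y; rewrite /H;
      have -> : perm_config (tperm i j) (perm_config (tperm i j) y) = y.
      by apply/ffunP => k; rewrite !ffunE tpermK.
    by lra.
  move=> y; rewrite /H glauber_opD glauber_opZ -[X in _ + _ * X]glauber_op_perm !GF; ring.
by move: Hx; rewrite /H; lra.
Qed.

End Symmetries.
(** * Spectra of kernels *)

Section KernelMatrix.
Variables (R : realType) (T : finType) (P : T -> T -> R).

Lemma eigenvalue_trmx (F : fieldType) m (A : 'M[F]_m) : eigenvalue A^T =1 eigenvalue A.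
Proof.
move=> a; rewrite !eigenvalue_root_char; congr (root _ a).
rewrite /char_poly -det_tr; congr (\det _); apply/matrixP => i j.
by rewrite !mxE eq_sym.
Qed.

Lemma sum_enum_val (V : nmodType) (h : T -> V) : \sum_(i < #|T|) h (enum_val i) = \sum_t
  h t.
Proof. by rewrite (reindex (@enum_val T predT)) //=; apply: onW_bij;
  exact: enum_val_bij. Qed.

Lemma eigenvalue_kernel (z : R[i]) : eigenvalue (kernel_matrix P) z ->
  exists a b : T -> R, (exists t, (a t != 0) || (b t != 0)) /\ forall t,
    \sum_u P t u * a u = complex.Re z * a t - complex.Im z * b t /\
    \sum_u P t u * b u = complex.Re z * b t + complex.Im z * a t.
Proof.
(* Transposing passes from row eigenvectors to functions on which [P] acts. *)
rewrite -eigenvalue_trmx => /eigenvalueP[v vz v0].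
exists (fun t => complex.Re (v 0 (enum_rank t))), (fun t => complex.Im (v 0 (enum_rank
  t))).
split.
  have /rV0Pn[i vi] := v0; exists (enum_val i); rewrite enum_valK.
  apply: contraNT vi; rewrite negb_or !negbK; case: (v 0 i) => vr vi' /=.
  by move=> /andP[/eqP-> /eqP->].
move=> t; have := congr1 (fun w : 'rV_#|T| => w 0 (enum_rank t)) vz.
rewrite !mxE => E.
have {}E : \sum_u (P t u)%:C%C * v 0 (enum_rank u) = z * v 0 (enum_rank t).
  rewrite -E -sum_enum_val; apply: eq_bigr => i _.
  by rewrite !mxE enum_valK enum_rankK mulrC.
have := congr1 (@complex.Re R) E; have := congr1 (@complex.Im R) E.
rewrite !raddf_sum /=.
have -> : complex.Im (z * v 0 (enum_rank t)) = complex.Re z * complex.Im (v 0 (enum_rank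
  t)) + complex.Im z * complex.Re (v 0 (enum_rank t)).
  by case: z {E vz} => zr zi; case: (v _ _).
have -> : complex.Re (z * v 0 (enum_rank t)) = complex.Re z * complex.Re (v 0 (enum_rank
  t)) - complex.Im z * complex.Im (v 0 (enum_rank t)).
  by case: z {E vz} => zr zi; case: (v _ _).
move=> <- <-; split; apply: eq_bigr => u _; case: (v _ _) => vr vi /=.
  by rewrite mul0r subr0.
by rewrite mul0r addr0.
Qed.

Lemma kernel_eigenvalue (a : T -> R) (z : R) (t0 : T) : a t0 != 0 ->
  (forall t, \sum_u P t u * a u = z * a t) -> eigenvalue (kernel_matrix P) z%:C%C.
Proof.
move=> a0 Pa; rewrite -eigenvalue_trmx; apply/eigenvalueP.
exists (\row_j (a (enum_val j))%:C%C); last first.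
  apply/rV0Pn; exists (enum_rank t0); rewrite mxE enum_rankK.
  by apply: contraNneq a0 => /(congr1 (@complex.Re R)) /= ->.
apply/rowP => j; rewrite !mxE -rmorphM -Pa rmorph_sum /= -sum_enum_val.
by apply: eq_bigr => i _; rewrite !mxE mulrC rmorphM.
Qed.

End KernelMatrix.

(** * Rayleigh quotients of a real symmetric kernel *)

Section SymmetricSpectrum.
Local Open Scope sesquilinear_scope.
Variables (R : realType) (T : finType) (S : T -> T -> R).
Hypothesis S_sym : forall s t, S s t = S t s.

(* Expand [v] in an orthonormal eigenbasis of [S]: some eigenvector that is not
   orthogonal to [v] has an eigenvalue at least the Rayleigh quotient of [v]. *)
Lemma rayleigh_eigenvector (v : T -> R) (rho : R) (t0 : T) : v t0 != 0 ->
  rho * \sum_t v t ^+ 2 <= \sum_t v t * \sum_u S t u * v u ->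
  exists lam (e : T -> R), [/\ rho <= lam,
    forall t, \sum_u S t u * e u = lam * e t & \sum_t v t * e t != 0].
Proof.
move=> v0 ray.
pose A := kernel_matrix S; pose P := spectralmx A; pose D := spectral_diag A.
have Ah : A \is hermsymmx.
  apply: realsym_hermsym.
    by apply/is_hermitianmxP/matrixP => i j; rewrite expr0 scale1r !mxE S_sym.
  apply/mxOverP => i j; rewrite mxE; apply/complex_realP;
    by exists (S (enum_val i) (enum_val j)).
have PU : P \is unitarymx := spectral_unitarymx A.
have PtP : P ^t* *m P = 1%:M by rewrite -invmx_unitary // mulVmx // unitarymx_unit.
have PPt : P *m P ^t* = 1%:M by apply/unitarymxP.
have AE : A = P ^t* *m diag_mx D *m P.
  by rewrite -invmx_unitary //; exact/orthomx_spectralP/hermitian_normalmx.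
pose d k := complex.Re (D 0 k).
have DE k : D 0 k = (d k)%:C%C.
  by rewrite RRe_real //; have /mxOverP := hermitian_spectral_diag_real Ah; apply.
pose V : 'rV[R[i]]_#|T| := \row_i (v (enum_val i))%:C%C.
pose c := V *m P ^t*.
(* [m k] is the weight of [v] along the [k]-th eigenvector; both sums in [ray] become sums over [k]
   with these weights. *)
pose m k := complex.Re `|c 0 k| ^+ 2.
have mE k : c 0 k * (c 0 k)^* = (m k)%:C%C.
  rewrite -normCK -[in LHS](RRe_real (normr_real (c 0 k))) /m.
  by rewrite -rmorphXn.
have Vt : V ^t* = V^T.
  by apply/matrixP => i j; rewrite !mxE; apply/CrealP/complex_realP;
    exists (v (enum_val i)).
have ct : c ^t* = P *m V^T by rewrite /c trmx_mul map_mxM -/(V ^t*) Vt trmxCK.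
have sqE : \sum_t v t ^+ 2 = \sum_k m k.
  apply: complexI; rewrite !rmorph_sum /=.
  have : (V *m V^T) 0 0 = (c *m c ^t*) 0 0.
    by rewrite ct /c -!mulmxA (mulmxA _ P) PtP mul1mx.
  rewrite [LHS]mxE [RHS]mxE => E; transitivity (\sum_j V 0 j * V^T j 0).
    by rewrite -sum_enum_val; apply: eq_bigr => i _; rewrite !mxE -rmorphM.
  by rewrite E; apply: eq_bigr => k _; rewrite -mE !mxE.
have formE : \sum_t v t * \sum_u S t u * v u = \sum_k d k * m k.
  apply: complexI; rewrite !rmorph_sum /=.
  have : (V *m (A *m V^T)) 0 0 = (c *m (diag_mx D *m c ^t*)) 0 0.
    by rewrite ct AE /c -!mulmxA.
  rewrite [LHS]mxE [RHS]mxE => E; transitivity (\sum_j V 0 j * (A *m V^T) j 0).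
    rewrite -sum_enum_val; apply: eq_bigr => i _; rewrite !mxE rmorphM /=.
    congr (_ * _); rewrite rmorph_sum /= -sum_enum_val; apply: eq_bigr => j _.
    by rewrite !mxE -rmorphM.
  rewrite E; apply: eq_bigr => k _; rewrite mul_diag_mx !mxE rmorphM /= -mE DE.
  by rewrite mulrCA !mxE.
(* Otherwise [d k < rho] whenever [m k] is nonzero, and the weighted sum of the [d k] falls short of
   [rho] times the total weight. *)
have [k /andP[mk dk]] : exists k, (m k != 0) && (rho <= d k).
  apply/existsP; apply: contraTT ray; rewrite negb_exists -ltNge => /forallP no.
  have m0 k : 0 <= m k by exact: sqr_ge0.
  have sq0 : 0 < \sum_t v t ^+ 2.
    rewrite (bigD1 t0) //= ltr_pwDl ?exprn_even_gt0 //.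
    by apply: sumr_ge0 => t _; exact: sqr_ge0.
  rewrite formE sqE mulr_sumr; rewrite sqE in sq0.
  have [k mk] : exists k, m k != 0.
    apply/existsP; apply: contraTT sq0; rewrite negb_exists => /forallP z.
    by rewrite big1 ?ltxx // => k _; apply/eqP; have := z k; rewrite negbK.
  rewrite (bigD1 k) //= [ltRHS](bigD1 k) //= ltr_leD //.
    rewrite ltr_pM2r ?lt0r ?mk ?m0 //; have := no k.
    by rewrite mk /= -ltNge.
  apply: ler_sum => l _; have [->|ml] := eqVneq (m l) 0; first by rewrite !mulr0.
  rewrite ler_wpM2r //; have := no l; rewrite ml /= -ltNge; exact: ltW.
pose e t : R[i] := P k (enum_rank t).
have eig t : \sum_u (S t u)%:C%C * e u = (d k)%:C%C * e t.
  have : (P *m A) k (enum_rank t) = (diag_mx D *m P) k (enum_rank t).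
    by rewrite AE !mulmxA PPt mul1mx.
  rewrite mul_diag_mx !mxE DE -/(e t) => <-; rewrite -sum_enum_val.
  by apply: eq_bigr => i _; rewrite !mxE /e enum_valK enum_rankK mulrC S_sym.
have cE : c 0 k = \sum_t (v t)%:C%C * (e t)^*.
  rewrite mxE -[RHS]sum_enum_val; apply: eq_bigr => i _.
  by rewrite !mxE /e enum_valK.
have ReE : complex.Re (c 0 k) = \sum_t v t * complex.Re (e t).
  rewrite cE raddf_sum.
 apply: eq_bigr => t _ /=.
  by case: (e t) => er ei /=; rewrite mul0r subr0.
have ImE : complex.Im (c 0 k) = - \sum_t v t * complex.Im (e t).
  rewrite cE raddf_sum -sumrN; apply: eq_bigr => t _ /=.
  by case: (e t) => er ei /=; rewrite mul0r addr0 mulrN.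
(* [S] is real, so the real and the imaginary part of [e] both satisfy the eigenvalue equation; as
   [c 0 k] is nonzero, one of them is not orthogonal to [v]. *)
have [re0|re0] := eqVneq (\sum_t v t * complex.Re (e t)) 0; last first.
  exists (d k), (fun t => complex.Re (e t)); split=> // t.
  have /(congr1 (@complex.Re R)) := eig t; rewrite raddf_sum /=.
  case: (e t) => er ei /=; rewrite mul0r subr0 => <-.
  by apply: eq_bigr => u _; case: (e u) => ur ui /=; rewrite mul0r subr0.
exists (d k), (fun t => complex.Im (e t)); split=> // [t|].
  have /(congr1 (@complex.Im R)) := eig t; rewrite raddf_sum /=.
  case: (e t) => er ei /=; rewrite mul0r addr0 => <-.
  by apply: eq_bigr => u _; case: (e u) => ur ui /=; rewrite mul0r addr0.
apply: contraNneq mk => im0; rewrite /m normc_def /= ReE re0 ImE im0.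
by rewrite oppr0 expr0n /= addr0 sqrtr0 expr0n.
Qed.

End SymmetricSpectrum.

(** * Even functions and the censored dynamics *)

Section EvenSpectrum.
Variables (R : realType) (n : nat) (beta : R).
Implicit Types (x y z : config n) (F : config n -> R).

Definition even_fun F := forall x, F (flip x) = F x.

(** Symmetry of the Glauber form, tested on the indicators of [x] and [y]. *)
Lemma detailed_balance x y :
  gibbs_weight beta x * glauber beta x y = gibbs_weight beta y * glauber beta y x.
Proof.
have ind u v : glauber_op beta (fun z => (z == v)%:R) u = glauber beta u v.
  rewrite -glauber_sumE (bigD1 v) //= eqxx mulr1 big1 ?addr0 // => z zv.
  by rewrite (negbTE zv) mulr0.
have form u v : \sum_z gibbs_weight beta z * (z == u)%:R *
    glauber_op beta (fun z => (z == v)%:R) z = gibbs_weight beta u * glauber beta u v.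
  rewrite (bigD1 u) //= eqxx mulr1 ind big1 ?addr0 // => z zu.
  by rewrite (negbTE zu) mulr0 mul0r.
by rewrite -!form glauber_op_sym.
Qed.

Lemma weighted_square_gt0 F x : F x != 0 -> 0 < \sum_y gibbs_weight beta y * F y ^+ 2.
Proof.
move=> Fx; rewrite (bigD1 x) //=; apply: ltr_pwDl;
  first by rewrite mulr_gt0 ?gibbs_weight_gt0 ?exprn_even_gt0.
by apply: sumr_ge0 => y _; rewrite mulr_ge0 ?sqr_ge0 // ltW ?gibbs_weight_gt0.
Qed.

(** Conjugation by the square root of the Gibbs weight turns the reversible kernel into the
    symmetric [S]. The eigenvector found there need not be even, but adding its flip keeps the
    eigenvalue and doubles its pairing with the even function [F]. *)
Lemma glauber_rayleigh F (rho : R) x0 : even_fun F -> F x0 != 0 ->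
  rho * \sum_x gibbs_weight beta x * F x ^+ 2
    <= \sum_x gibbs_weight beta x * F x * glauber_op beta F x ->
  exists lam g, [/\ rho <= lam, even_fun g,
    forall x, glauber_op beta g x = lam * g x &
    \sum_x gibbs_weight beta x * F x * g x != 0].
Proof.
move=> Feven F0 ray.
pose w (x : config n) := Num.sqrt (gibbs_weight beta x).
have w0 x : w x != 0 by rewrite gt_eqF // sqrtr_gt0 gibbs_weight_gt0.
have ww x : w x * w x = gibbs_weight beta x.
  by rewrite -expr2 sqr_sqrtr // ltW ?gibbs_weight_gt0.
pose S x y := w x * glauber beta x y / w y.
have Ssym x y : S x y = S y x.
  apply: (mulfI (w0 x)); apply: (mulIf (w0 y)).
  rewrite /S; transitivity (gibbs_weight beta x * glauber beta x y).
    by rewrite -ww; field; exact: w0.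
  by rewrite detailed_balance -ww; field; exact: w0.
have SE x (e : config n -> R) : \sum_u S x u * (w u * e u) = w x * glauber_op beta e x.
  rewrite -glauber_sumE mulr_sumr; apply: eq_bigr => u _.
  by rewrite /S -!mulrA mulKf // .
have [||lam [e [rl eig ve]]] := @rayleigh_eigenvector R _ S Ssym (fun x => w x * F x)
  rho x0.
- by rewrite mulf_neq0.
- move: ray; congr (_ * _ <= _); apply: eq_bigr => x _; last rewrite SE; rewrite -ww;
  ring.
pose g x := e x / w x.
have eg x : e x = w x * g x by rewrite /g mulrC divfK.
have Gg x : glauber_op beta g x = lam * g x.
  apply: (mulfI (w0 x)); rewrite -SE; under eq_bigr do rewrite -eg.
  by rewrite eig eg mulrCA.
exists lam, (fun x => g x + g (flip x)); split=> //.
- by move=> x; rewrite flipK addrC.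
- move=> x; rewrite glauber_opD Gg -(glauber_op_flip beta g) Gg; ring.
have E : \sum_x gibbs_weight beta x * F x * g (flip x) = \sum_x gibbs_weight beta x * F
  x * g x.
  rewrite [RHS](reindex_inj (can_inj (@flipK n))) /=.
  by apply: eq_bigr => x _; rewrite gibbs_weight_flip Feven.
under eq_bigr do rewrite mulrDr; rewrite big_split /= E.
have -> : \sum_x gibbs_weight beta x * F x * g x = \sum_x w x * F x * e x.
  by apply: eq_bigr => x _; rewrite eg -ww; ring.
by rewrite -mulr2n mulrn_eq0.
Qed.

End EvenSpectrum.

(** * Eigenvalues of the censored chain *)

Section CensoredSpectrum.
Variables (R : realType) (n : nat) (beta : R).
Implicit Types (x y z : config n) (F : config n -> R).

Lemma censor_ge0 x : 0 <= total_spin (censor x).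
Proof. by rewrite /censor; case: ltP => //; rewrite total_spin_flip; lia. Qed.

Definition to_censored x : censored_state n := Sub (censor x) (censor_ge0 x).

Lemma to_censoredK (s : censored_state n) : to_censored (val s) = s.
Proof. by apply/val_inj; rewrite /= /censor ltNge (valP s). Qed.

Lemma to_censored_flip x : total_spin x != 0 -> to_censored (flip x) = to_censored x.
Proof.
move=> x0; apply/val_inj; rewrite /= /censor total_spin_flip flipK oppr_lt0.
by case: ltgtP x0.
Qed.

Lemma censored_sumE (s : censored_state n) (h : censored_state n -> R) :
  \sum_t censored_glauber beta s t * h t = glauber_op beta (h \o to_censored) (val s).
Proof.
rewrite -glauber_sumE /censored_glauber.
under eq_bigr do rewrite mulr_suml.
rewrite (exchange_big_dep predT) //=; apply: eq_bigr => z _.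
by rewrite (big_pred1 (to_censored z)).
Qed.

(** Censoring does not change the value of an even function, so [F] descends to the censored
    states. *)
Lemma even_eigen_censored F (lam : R) x0 : even_fun F -> F x0 != 0 ->
  (forall x, glauber_op beta F x = lam * F x) ->
  eigenvalue (kernel_matrix (@censored_glauber R n beta)) lam%:C%C.
Proof.
move=> eF F0 GF.
have Fc x : F (censor x) = F x by rewrite /censor; case: ifP.
apply: (@kernel_eigenvalue _ _ _ (fun s => F (val s)) lam (to_censored x0)).
  by rewrite /= Fc.
move=> s; rewrite censored_sumE -GF; apply: eq_glauber_op => x.
by rewrite /= Fc.
Qed.

Hypotheses (n_gt0 : (0 < n)%N) (beta_ge0 : 0 <= beta).

(** Changing one spin of a balanced configuration makes it unbalanced, where [h] vanishes. Only the
    updates that keep the spin count, and their probability is the same for both spins by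
    [p_plusN]. *)
Lemma antisymmetric_hold (h : config n -> R) x : total_spin x = 0 ->
  (forall y, total_spin y != 0 -> h y = 0) ->
  glauber_op beta h x = p_plus beta (- n%:R^-1) * h x.
Proof.
move=> x0 hz; rewrite /glauber_op (eq_bigr (fun=> p_plus beta (- n%:R^-1) * h x)).
  rewrite sumr_const card_ord -[X in _ * X]mulr_natl mulKf //.
  by rewrite pnatr_eq0 -lt0n.
move=> i _; rewrite /site_mean big_bool /=.
have [-> ->] := heat_bathE beta x i.
have moved b : x i = ~~ b -> h (set_spin x i b) = 0.
  move=> xi; apply: hz; move: x0; rewrite /total_spin (bigD1 i) //= => /eqP.
  rewrite addr_eq0 => /eqP E; rewrite (bigD1 i) //= ffunE eqxx.
  rewrite (eq_bigr (fun j => spin (x j))) => [|j ji]; last by rewrite ffunE (negbTE ji).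
  by rewrite xi in E; case: b xi E => /= xi; set S := \sum_(j < n | _) _ => E; lia.
rewrite /mean_spin x0 mul0r add0r; case xi : (x i).
  rewrite (moved false) ?xi // mulr0 addr0 -{2}xi set_spin_same /spin.
  by rewrite mul1r.
rewrite (moved true) ?xi // mulr0 add0r -{2}xi set_spin_same /spin.
by rewrite rmorphN mulNr opprK mul1r p_plusN.
Qed.

(** Lift the real and imaginary parts of an eigenvector to functions [A] and [B] of all
    configurations. If one of them separates a balanced configuration from its flip, the
    antisymmetric parts live on balanced configurations and force [z] to be the holding probability.
    Otherwise both are even, the Glauber operator acts on them, and its symmetry and nonnegativity
    decide. *)
Lemma censored_eigen (z : R[i]) :
  eigenvalue (kernel_matrix (@censored_glauber R n beta)) z ->
  exists2 r : R, z = r%:C%C & 0 <= r /\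
   (r <= 2^-1 \/ exists F, [/\ even_fun F, exists x, F x != 0 &
                           forall x, glauber_op beta F x = r * F x]).
Proof.
case/eigenvalue_kernel => a [b [nz eig]]; case: z eig => zr zi /= eig.
pose A x := a (to_censored x); pose B x := b (to_censored x).
have PA x : glauber_op beta A (censor x) = zr * A x - zi * B x.
  by have [<- _] := eig (to_censored x); rewrite censored_sumE.
have PB x : glauber_op beta B (censor x) = zr * B x + zi * A x.
  by have [_ <-] := eig (to_censored x); rewrite censored_sumE.
have cens0 x : total_spin x = 0 -> censor x = x by rewrite /censor => ->; rewrite ltxx.
have antiG (h : censored_state n -> R) x : total_spin x = 0 ->
    glauber_op beta (h \o to_censored) x - glauber_op beta (h \o to_censored) (flip x)
    = p_plus beta (- n%:R^-1) * (h (to_censored x) - h (to_censored (flip x))).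
  move=> x0; pose D y := h (to_censored y) + -1 * h (to_censored (flip y)).
  have -> : h (to_censored x) - h (to_censored (flip x)) = D x by rewrite /D mulN1r.
  rewrite -(@antisymmetric_hold D x) // => [|y y0].
    by rewrite glauber_opD glauber_opZ mulN1r (glauber_op_flip beta (h \o to_censored)).
  by rewrite /D to_censored_flip // mulN1r subrr.
pose p := p_plus beta (- n%:R^-1).
have [/existsP[x /andP[/eqP x0 ABx]]|noD] :=
  boolP [exists x : config n, (total_spin x == 0) &&
    ((A x - A (flip x) != 0) || (B x - B (flip x) != 0))].
  have fx0 : total_spin (flip x) = 0 by rewrite total_spin_flip x0 oppr0.
  have := antiG a x x0;
    rewrite -/A -/p -{1}(cens0 _ x0) -{1}(cens0 _ fx0) !PA -/(A x) -/(A (flip x)).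
  have := antiG b x x0;
    rewrite -/B -/p -{1}(cens0 _ x0) -{1}(cens0 _ fx0) !PB -/(B x) -/(B (flip x)).
  set da := A x - A (flip x) in ABx *; set db := B x - B (flip x) in ABx *.
  move=> E1 E2.
  have {}E1 : (zr - p) * db = - zi * da.
    by apply/eqP; rewrite -subr_eq0; apply/eqP; rewrite mulrBl -E1 /da /db; ring.
  have {}E2 : (zr - p) * da = zi * db.
    by apply/eqP; rewrite -subr_eq0; apply/eqP; rewrite mulrBl -E2 /da /db; ring.
  (* The equations [E1] and [E2] say that the complex numbers with parts [zr - p, zi] and [da, db]
     have product 0, and the second one is nonzero. *)
  have N : (zr - p) ^+ 2 + zi ^+ 2 = 0.
    have Nda : ((zr - p) ^+ 2 + zi ^+ 2) * da = 0.
      by rewrite mulrDl !expr2 -mulrA E2 mulrCA E1; ring.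
    have Ndb : ((zr - p) ^+ 2 + zi ^+ 2) * db = 0.
      by rewrite mulrDl !expr2 -mulrA E1 mulrCA E2; ring.
    by case/orP: ABx => nz0; apply: (mulIf nz0); rewrite mul0r.
  have /andP[] : (zr - p == 0) && (zi == 0).
    by move/eqP: N; rewrite paddr_eq0 ?sqr_ge0 // !sqrf_eq0.
  rewrite subr_eq0 => /eqP zrp /eqP zi0.
  exists p; first by rewrite zi0 zrp.
  split; first exact/ltW/p_plus_gt0.
  left; have : p_plus beta (- n%:R^-1) <= p_plus beta n%:R^-1.
    by rewrite p_plus_homo // (@le_trans _ _ 0) ?oppr_le0 ?invr_ge0.
  by rewrite -/p; have := p_plusN beta n%:R^-1; rewrite -/p; lra.
have even (h : censored_state n -> R) :
    (forall x, total_spin x = 0 -> h (to_censored x) - h (to_censored (flip x)) = 0) ->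
    even_fun (h \o to_censored).
  move=> h0 x /=; have [x0|x0] := eqVneq (total_spin x) 0;
    last by rewrite to_censored_flip.
  by apply/esym/eqP; rewrite -subr_eq0 h0.
have evenA : even_fun A.
  apply: even => x x0; apply/eqP; apply: contraNT noD => nzx.
  by apply/existsP; exists x; rewrite x0 eqxx nzx.
have evenB : even_fun B.
  apply: even => x x0; apply/eqP; apply: contraNT noD => nzx.
  by apply/existsP; exists x; rewrite x0 eqxx nzx orbT.
have censG F x : even_fun F -> glauber_op beta F (censor x) = glauber_op beta F x.
  move=> eF; rewrite /censor; case: ifP => // _; rewrite glauber_op_flip.
  exact: eq_glauber_op.
have GA x : glauber_op beta A x = zr * A x - zi * B x by rewrite -PA censG.
have GB x : glauber_op beta B x = zr * B x + zi * A x by rewrite -PB censG.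
have [t t0] := nz.
have nzAB : (A (val t) != 0) || (B (val t) != 0) by rewrite /A /B to_censoredK.
(* Symmetry equates the pairing of [B] with the image of [A] and that of [A] with the image of [B];
   their difference is [zi] times a positive sum of squares. *)
have zi0 : zi = 0.
  have := glauber_op_sym beta B A.
  under eq_bigr do rewrite GA; under [X in _ = X]eq_bigr do rewrite GB.
  move=> E; have : zi * (\sum_x gibbs_weight beta x * (A x ^+ 2)
                   + \sum_x gibbs_weight beta x * (B x ^+ 2)) = 0.
    transitivity (\sum_x gibbs_weight beta x * A x * (zr * B x + zi * A x)
                - \sum_x gibbs_weight beta x * B x * (zr * A x - zi * B x)).
      by rewrite -big_split -sumrB mulr_sumr; apply: eq_bigr => x _ /=; ring.
    by rewrite E subrr.
  move/eqP; rewrite mulf_eq0 => /orP[/eqP//|].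
  have sq0 (F : config n -> R) : 0 <= \sum_x gibbs_weight beta x * F x ^+ 2.
    by apply: sumr_ge0 => x _; rewrite mulr_ge0 ?sqr_ge0 // ltW ?gibbs_weight_gt0.
  have := sq0 A; have := sq0 B => B0 A0.
  by case/orP: nzAB => /(weighted_square_gt0 beta); lra.
have {}GA x : glauber_op beta A x = zr * A x by rewrite GA zi0 mul0r subr0.
have {}GB x : glauber_op beta B x = zr * B x by rewrite GB zi0 mul0r addr0.
have [F [eF [x Fx] GF]] : exists F, [/\ even_fun F, exists x, F x != 0 &
                           forall x, glauber_op beta F x = zr * F x].
  by case/orP: nzAB => ABt; [exists A|exists B]; split=> //; exists (val t).
exists zr; first by rewrite zi0.
split; last by right; exists F; split=> //; exists x.
have := glauber_op_ge0 beta F; under eq_bigr do rewrite GF mulrCA -mulrA -expr2.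
by rewrite -mulr_sumr pmulr_lge0 // (weighted_square_gt0 beta Fx).
Qed.

End CensoredSpectrum.

(** * The birth-death chain of the total spin *)

Section BirthDeath.
Variables (R : realType) (n : nat) (beta : R).
Implicit Types (x y : config n) (F : config n -> R) (psi : R -> R).
Local Notation K x := ((total_spin x)%:~R : R).

(** The probability that the total spin jumps from [k] to [k + 2]: a minus spin is picked with
    probability [(n - k) / (2 n)], and the other spins then sum to [k + 1]. *)
Definition up_rate (k : R) : R :=
  (n%:R - k) / (2 * n%:R) * p_plus beta ((k + 1) / n%:R).

Definition down_rate (k : R) : R :=
  (n%:R + k) / (2 * n%:R) * (1 - p_plus beta ((k - 1) / n%:R)).

Definition generator psi (k : R) : R :=
  up_rate k * (psi (k + 2) - psi k) + down_rate k * (psi (k - 2) - psi k).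

Lemma up_rateN k : up_rate (- k) = down_rate k.
Proof.
by rewrite /up_rate /down_rate opprK -p_plusN -mulNr opprB addrC [in p_plus _ _]addrC.
Qed.

Lemma generatorN psi k : (forall t, psi (- t) = psi t) ->
  generator psi (- k) = generator psi k.
Proof.
move=> ev; have dN : down_rate (- k) = up_rate k by rewrite -up_rateN opprK.
rewrite /generator up_rateN dN addrC ev.
rewrite (_ : - k - 2 = - (k + 2)); last by ring.
by rewrite (_ : - k + 2 = - (k - 2)) ?ev //; ring.
Qed.

Lemma total_spin_set x i b :
  total_spin (set_spin x i b) = total_spin x + (spin b - spin (x i)).
Proof.
rewrite /total_spin (bigD1 i) //= [in RHS](bigD1 i) //= ffunE eqxx.
rewrite (eq_bigr (fun j => spin (x j))) => [|j ji]; last by rewrite ffunE (negbTE ji).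
by ring.
Qed.

Lemma total_spin_bound x : `|total_spin x| <= n%:Z.
Proof.
apply: (le_trans (ler_norm_sum _ _ _)).
rewrite (eq_bigr (fun=> 1)) => [|i _]; last by rewrite /spin; case: (x i).
by rewrite sumr_const card_ord natz.
Qed.

Lemma total_spin_parity x y : exists m : int, total_spin x - total_spin y = m *+ 2.
Proof.
exists (#|[pred i | x i]|%:Z - #|[pred i | y i]|%:Z).
by rewrite !total_spinE; ring.
Qed.

Lemma config_of_total_spin (j : nat) : (j <= n)%N ->
  exists x, total_spin x = j%:Z *+ 2 - n%:Z.
Proof.
move=> jn; exists [ffun i : 'I_n => (i < j)%N].
rewrite total_spinE; congr (Posz _ *+ 2 - _).
rewrite -sum1_card (eq_bigl (fun i : 'I_n => (i < j)%N)); last by move=> i;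
  rewrite !inE ffunE.
by rewrite -(big_ord_widen n (fun=> 1%N) jn) sum1_card card_ord.
Qed.

Hypothesis n_gt0 : (0 < n)%N.

Lemma glauber_op_total_spin psi x :
  glauber_op beta (fun y => psi (K y)) x = psi (K x) + generator psi (K x).
Proof.
have n0 : n%:R != 0 :> R by rewrite pnatr_eq0 -lt0n.
set k := K x.
(* An update at a plus spin has mean [psi k + a], one at a minus spin [psi k + b]. Written as an
   affine function of the spin, this sums over the sites to an expression in the total spin
   alone. *)
pose a := (1 - p_plus beta ((k - 1) / n%:R)) * (psi (k - 2) - psi k).
pose b := p_plus beta ((k + 1) / n%:R) * (psi (k + 2) - psi k).
have site i : site_mean beta (fun y => psi (K y)) i x
    = psi k + ((a + b) / 2 + (spin (x i))%:~R * ((a - b) / 2)).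
  rewrite /site_mean big_bool /= !total_spin_set.
  have [-> ->] := heat_bathE beta x i.
  rewrite /mean_spin -mulrBl -/k !rmorphD /= !rmorphN /= -/k /spin.
  case: (x i); rewrite /= ?subrr ?addr0 ?opprK ?rmorphN /=.
    rewrite (_ : k + (-1 - 1) = k - 2); last by ring.
    by rewrite /a /b; lra.
  rewrite (_ : k + (1 + 1) = k + 2); last by ring.
  by rewrite ?addNr ?subrr ?addr0 /a /b; lra.
rewrite /glauber_op (eq_bigr _ (fun i _ => site i)) big_split /= big_split /=.
rewrite !sumr_const card_ord -mulr_suml -rmorph_sum /= -/(total_spin x) -/k.
rewrite -(mulr_natl (psi k)) -(mulr_natl ((a + b) / 2)).
rewrite /generator /up_rate /down_rate -[(_ - k) / _ * _ * _]mulrA -[(_ + k) / _ * _ *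
  _]mulrA -/a -/b.
by field.
Qed.

Lemma glauber_op_homo U V x :
  (forall i b, U (set_spin x i b) <= V (set_spin x i b)) ->
  glauber_op beta U x <= glauber_op beta V x.
Proof.
move=> UV; rewrite /glauber_op ler_wpM2l ?invr_ge0 //.
apply: ler_sum => i _; apply: ler_sum => b _.
by rewrite ler_wpM2l ?UV // ltW ?heat_bath_gt0.
Qed.

(** Maximum principle: let [x] maximise [- F / Psi] on [A], with maximum [r]. Then [- F <= r * Psi]
    at every configuration one step from [x], in [A] by maximality and outside by the sign
    conditions; applying the monotone Glauber operator at [x] compares [lam] with [1 - eps]. *)
Lemma supersolution_eigenvalue (A : pred (config n)) Psi F (lam eps : R) y0 :
  (forall x, A x -> 0 < Psi x) ->
  (forall x, A x -> glauber_op beta Psi x <= (1 - eps) * Psi x) ->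
  (forall x i b, A x -> ~~ A (set_spin x i b) ->
     0 <= F (set_spin x i b) /\ 0 <= Psi (set_spin x i b)) ->
  (forall x, glauber_op beta F x = lam * F x) ->
  A y0 -> F y0 < 0 -> lam <= 1 - eps.
Proof.
move=> Psi0 super bd GF Ay0 Fy0.
have [x Ax xmax] := arg_maxP (fun y => - F y / Psi y) Ay0.
set r := - F x / Psi x in xmax.
have r0 : 0 < r by apply: lt_le_trans (xmax _ Ay0); rewrite divr_gt0 ?oppr_gt0 ?Psi0.
have Fx : - F x = r * Psi x by rewrite /r divfK // gt_eqF ?Psi0.
have dom y : A y -> - F y <= r * Psi y.
  by move=> Ay; rewrite -ler_pdivrMr ?Psi0 //; exact: xmax.
have : glauber_op beta (fun y => -1 * F y) x <= glauber_op beta (fun y => r * Psi y) x.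
  apply: glauber_op_homo => i b; rewrite mulN1r.
  have [|/(bd _ _ _ Ax)[F0 P0]] := boolP (A (set_spin x i b)); first exact: dom.
  by apply: (@le_trans _ _ 0); [rewrite oppr_le0 | rewrite mulr_ge0 // ltW].
rewrite !glauber_opZ GF mulN1r -mulrN Fx => le1.
have rP : 0 < r * Psi x by rewrite mulr_gt0 ?Psi0.
rewrite -(ler_pM2r rP) (le_trans le1) // [leRHS]mulrCA; apply: ler_wpM2l;
  [exact: ltW | exact: super].
Qed.

(** Up to a change of sign [F] is nonnegative at [|k| = c], and mean zero then gives a negative
    value strictly on one side. Total spins have the parity of [c] and move by at most 2, so a side
    can be left only through [|k| = c], where [psiL] and [psiR] vanish. *)
Lemma eigenvalue_two_wells (c : int) (psiL psiR : R -> R) (eps lam : R) F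
    (xc y0 : config n) :
  0 < c -> total_spin xc = c ->
  (forall t, psiL (- t) = psiL t) -> (forall t, psiR (- t) = psiR t) ->
  psiL c%:~R = 0 -> psiR c%:~R = 0 ->
  (forall k : int, 0 <= k -> k + 2 <= c -> 0 < psiL k%:~R /\
     generator psiL k%:~R <= - eps * psiL k%:~R) ->
  (forall k : int, c + 2 <= k -> k <= n%:Z -> 0 < psiR k%:~R /\
     generator psiR k%:~R <= - eps * psiR k%:~R) ->
  even_fun F -> (forall x y, total_spin x = total_spin y -> F x = F y) ->
  \sum_x gibbs_weight beta x * F x = 0 ->
  (forall x, glauber_op beta F x = lam * F x) -> F y0 != 0 -> lam <= 1 - eps.
Proof.
move=> c0 xcE Lev Rev Lc Rc superL superR eF tF mean0 GF Fy0.
wlog Fc : F eF tF mean0 GF Fy0 / 0 <= F xc.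
  move=> th; have [|Fneg] := leP 0 (F xc); first exact: th.
  apply: (th (fun x => -1 * F x)).
  - by move=> x; rewrite eF.
  - by move=> x y /tF ->.
  - by under eq_bigr do rewrite mulrCA; rewrite -mulr_sumr mean0 mulr0.
  - by move=> x; rewrite glauber_opZ GF mulrCA.
  - by rewrite mulN1r oppr_eq0.
  - by rewrite mulN1r oppr_ge0 ltW.
have Fabs x : `|total_spin x| = c -> 0 <= F x.
  move=> xc'; have [x0|x0] := leP 0 (total_spin x).
    by rewrite (tF x xc) // xcE -xc' ger0_norm.
  by rewrite -eF (tF _ xc) // xcE total_spin_flip -xc' ltr0_norm.
have [y Fy] : exists y, F y < 0.
  apply/existsP; apply: contraTT (lexx (0 : R)); rewrite negb_exists => /forallP pos.
  rewrite -ltNge -[ltRHS]mean0 (bigD1 y0) //=.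
  have wF x : 0 <= gibbs_weight beta x * F x.
    by rewrite mulr_ge0 ?(ltW (gibbs_weight_gt0 _ _)) // leNgt pos.
  apply: ltr_pwDl; last by apply: sumr_ge0 => x _; exact: wF.
  by rewrite lt0r wF mulf_neq0 // gt_eqF ?gibbs_weight_gt0.
have super psi x : (forall t, psi (- t) = psi t) ->
    (0 < psi `|total_spin x|%:~R /\ generator psi `|total_spin x|%:~R <= - eps * psi
      `|total_spin x|%:~R) ->
    0 < psi (K x) /\ glauber_op beta (fun z => psi (K z)) x <= (1 - eps) * psi (K x).
  move=> ev; rewrite glauber_op_total_spin; have [x0|x0] := leP 0 (total_spin x).
    by rewrite ger0_norm // => -[-> ?]; split=> //; lra.
  by rewrite ltr0_norm // rmorphN /= ev generatorN // => -[-> ?]; split=> //; lra.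
have psi_abs psi x : (forall t, psi (- t) = psi t) -> `|total_spin x| = c ->
    psi (K x) = psi c%:~R.
  move=> ev <-; have [x0|x0] := leP 0 (total_spin x); first by rewrite ger0_norm.
  by rewrite ltr0_norm // rmorphN /= ev.
have par x : exists m : int, total_spin x = c + m *+ 2.
  by have [m] := total_spin_parity x xc; rewrite xcE => E; exists m; rewrite -E; lia.
have step x i b : exists e : int, [/\ total_spin (set_spin x i b) = total_spin x + e *+
  2, -1 <= e & e <= 1].
  rewrite total_spin_set;
    exists (if b then (if x i then 0 else 1) else (if x i then -1 else 0)).
  by rewrite /spin; case: b; case: (x i); split; lia.
have [yin|yout|yc] := ltgtP `|total_spin y| c; last by have := Fabs y yc; lra.
- apply: (@supersolution_eigenvalue (fun x => `|total_spin x| < c) (fun z => psiL (K z))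
  F lam eps y) => //.
  + move=> x xin; apply: (super _ _ Lev _).1; apply: superL; first exact: normr_ge0.
    by have [m] := par x; lia.
  + move=> x xin; apply: (super _ _ Lev _).2; apply: superL; first exact: normr_ge0.
    by have [m] := par x; lia.
  + move=> x i b xin nin; have xc' : `|total_spin (set_spin x i b)| = c.
      by have [e [E e1 e2]] := step x i b; have [m] := par x; lia.
    by split; [exact: Fabs | rewrite psi_abs // Lc].
- apply: (@supersolution_eigenvalue (fun x => c < `|total_spin x|) (fun z => psiR (K z))
  F lam eps y) => //.
  + move=> x xin; apply: (super _ _ Rev _).1; apply: superR; last exact: total_spin_bound.
    by have [m] := par x; lia.
  + move=> x xin; apply: (super _ _ Rev _).2; apply: superR; last exact: total_spin_bound.
    by have [m] := par x; lia.
  + move=> x i b xin nin; have xc' : `|total_spin (set_spin x i b)| = c.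
      by have [e [E e1 e2]] := step x i b; have [m] := par x; lia.
    by split; [exact: Fabs | rewrite psi_abs // Rc].
Qed.

End BirthDeath.

(** * The drift of the total spin *)

Section BiasFunction.
Variables (R : realType) (q : R).
Hypothesis q_ge1 : 1 <= q.
Implicit Types X Y s : R.

(* With [y = expR X], this is [sinh X / (cosh X + q)]. *)
Definition bias_ratio X : R :=
  (expR X ^+ 2 - 1) / (expR X ^+ 2 + 2 * q * expR X + 1).

(** The derivative of [bias_ratio], written through [2 cosh X] so that its monotonicity follows from
    that of [cosh]. *)
Definition bias_slope X : R :=
  2 * (q * (expR X + expR (- X)) + 2) / (expR X + expR (- X) + 2 * q) ^+ 2.

Lemma bias_den_gt0 X : 0 < expR X ^+ 2 + 2 * q * expR X + 1.
Proof.
have y0 := expR_gt0 X; have q0 : 0 < q := lt_le_trans ltr01 q_ge1.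
by rewrite !addr_gt0 ?mulr_gt0 ?exprn_gt0.
Qed.

Lemma bias_ratio0 : bias_ratio 0 = 0.
Proof. by rewrite /bias_ratio expR0 expr1n subrr mul0r. Qed.

Lemma is_derive_bias_ratio X : is_derive X 1 bias_ratio (bias_slope X).
Proof.
have D0 := bias_den_gt0 X.
pose D := (expR ^+ 2 + (2 * q) \*: expR + cst 1 : R -> R).
have dD : is_derive X 1 D (2 * expR X * expR X + 2 * q * expR X).
  by apply: is_derive_eq; rewrite /GRing.scale /=; ring.
have dDV : is_derive X 1 (fun x => (D x)^-1) (- (D X) ^- 2 *: (2 * expR X * expR X + 2 *
  q * expR X)).
  by apply: is_deriveV => //; rewrite /D /= gt_eqF.
have dN : is_derive X 1 (expR ^+ 2 - cst 1 : R -> R) (2 * expR X * expR X).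
  by apply: is_derive_eq; rewrite /GRing.scale /=; ring.
have DE : D X = expR X ^+ 2 + 2 * q * expR X + 1 by [].
have NE : (expR ^+ 2 - cst 1 : R -> R) X = expR X ^+ 2 - 1 by [].
apply: (is_derive_eq (is_deriveM dN dDV)).
rewrite DE NE /bias_slope expRN /GRing.scale /=.
have y0 := expR_gt0 X; move: (expR X) y0 D0 => y y0 D0.
have e1 : y != 0 by rewrite gt_eqF.
have e2 : y + y^-1 + 2 * q != 0.
  rewrite gt_eqF // !addr_gt0 ?invr_gt0 ?mulr_gt0 //; exact: lt_le_trans q_ge1.
by field; rewrite e1 /= gt_eqF //; move: D0; rewrite expr2; lra.
Qed.

Lemma exp_sum_ge2 X : 2 <= expR X + expR (- X).
Proof.
rewrite expRN; have y0 := expR_gt0 X; move: (expR X) y0 => y y0.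
rewrite -subr_ge0 (_ : _ - 2 = (y - 1) ^+ 2 / y);
  first by rewrite divr_ge0 ?sqr_ge0 // ltW.
by field; rewrite gt_eqF.
Qed.

Lemma exp_sum_homo X Y : 0 <= X -> X <= Y -> expR X + expR (- X) <= expR Y + expR (- Y).
Proof.
move=> X0 XY; have a1 : 1 <= expR X by rewrite -expR0 ler_expR.
have ab : expR X <= expR Y by rewrite ler_expR.
rewrite !expRN; move: (expR X) (expR Y) a1 ab => a b a1 ab.
have a0 : 0 < a by lra. have b0 : 0 < b by lra.
rewrite -subr_ge0 (_ : _ - _ = (b - a) * (a * b - 1) / (a * b)).
  have ab1 : 1 <= a * b by rewrite mulr_ege1 //; lra.
  by rewrite divr_ge0 ?mulr_ge0 ?subr_ge0 // ltW.
by field; rewrite !gt_eqF.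
Qed.

(** For two values [c <= d] of [2 cosh], cross-multiplication leaves [d - c] times a polynomial
    which is smallest at [c = d = 2], where it equals [4 (2 - q) (q + 1)^2]; hence the condition
    [q <= 2]. *)
Lemma bias_slope_nincr X Y : q <= 2 -> 0 <= X -> X <= Y -> bias_slope Y <= bias_slope X.
Proof.
move=> q2 X0 XY; rewrite /bias_slope.
have main (c d : R) : c <= d -> 2 <= c ->
    2 * (q * d + 2) / (d + 2 * q) ^+ 2 <= 2 * (q * c + 2) / (c + 2 * q) ^+ 2.
  move=> cd c2; have q1 := q_ge1.
  have d0 : 0 < (d + 2 * q) ^+ 2 by rewrite exprn_gt0 //; lra.
  have c0 : 0 < (c + 2 * q) ^+ 2 by rewrite exprn_gt0 //; lra.
  rewrite ler_pdivrMr // mulrAC ler_pdivlMr // -subr_ge0.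
  rewrite (_ : _ - _ = 2 * ((d - c) * (q * (c * d) + 2 * (c + d) + 8 * q - 4 * q ^+
    3))); last by ring.
  rewrite mulr_ge0 // mulr_ge0 ?subr_ge0 //.
  have h0 : 4 <= c * d by rewrite (_ : 4 = 2 * 2) ?ler_pM //; lra.
  have h1 : q * 4 <= q * (c * d) by rewrite ler_wpM2l //; lra.
  have h2 : 0 <= (2 - q) * (q + 1) ^+ 2 by rewrite mulr_ge0 ?sqr_ge0 // subr_ge0.
  by lra.
by apply: main; [exact: exp_sum_homo | exact: exp_sum_ge2].
Qed.

Lemma bias_MVT X Y : X < Y ->
  exists2 Z, X < Z < Y & bias_ratio Y - bias_ratio X = bias_slope Z * (Y - X).
Proof.
move=> XY; have [|Z] := MVT XY (fun x _ => is_derive_bias_ratio x).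
  by apply: derivable_within_continuous => x _; have [] := is_derive_bias_ratio x.
by rewrite in_itv; exists Z.
Qed.

Lemma bias_ratio_concave X Y Z : q <= 2 -> 0 <= X -> X < Y -> Y < Z ->
  (bias_ratio Z - bias_ratio Y) * (Y - X) <= (bias_ratio Y - bias_ratio X) * (Z - Y).
Proof.
move=> q2 X0 XY YZ.
have [u /andP[Xu uY] ->] := bias_MVT XY; have [v /andP[Yv vZ] ->] := bias_MVT YZ.
rewrite mulrAC ler_pM2r ?subr_gt0 // ler_pM2r ?subr_gt0 //.
by apply: bias_slope_nincr => //; lra.
Qed.

(** Raising [q] lowers the ratio, so the worst case is [q = 1], which is [tanh (X / 2)]. There the
    claimed bound minus the ratio vanishes at 0 and has nonnegative derivative because
    [z <= expR z - 1]. *)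
Lemma bias_ratio_le X0 X : 0 <= X -> X <= X0 ->
  bias_ratio X <= X / 2 - X ^+ 3 / (6 * (expR X0 + 1) ^+ 2).
Proof.
move=> Xge0 XX0; have q1 := q_ge1; set c := (6 * (expR X0 + 1) ^+ 2)^-1.
have y1 : 1 <= expR X by rewrite -expR0 ler_expR.
have tanh_le : bias_ratio X <= 1 - 2 * (expR X + 1)^-1.
  rewrite /bias_ratio ler_pdivrMr ?bias_den_gt0 //.
  move: (expR X) y1 => y y1; have y0 : 0 < y + 1 by lra.
  rewrite -subr_ge0 (_ : _ - _ = 2 * (q - 1) * y * (y - 1) / (y + 1)).
    by rewrite divr_ge0 ?mulr_ge0 //; lra.
  by field; rewrite gt_eqF.
apply: (le_trans tanh_le).
have [->|Xn0] := eqVneq X 0;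
  first by rewrite expR0 expr0n /= !mul0r subrr (_ : 1 - _ = 0) //; field.
pose f := (2^-1 \*: id - c \*: (id ^+ 3) - cst 1 + 2 \*: (fun x => (expR x + 1)^-1) : R
  -> R).
pose df (x : R) := 2^-1 - c * (3 * x ^+ 2) - 2 * (expR x / (expR x + 1) ^+ 2).
have derf (x : R) : is_derive x 1 f (df x).
  have n0 : expR x + 1 != 0 by rewrite gt_eqF // addr_gt0 ?expR_gt0.
  have dV : is_derive x 1 (fun x => (expR x + 1)^-1) (- (expR x + 1) ^- 2 *: (expR x)).
    apply: is_deriveV => //.
    have : is_derive x 1 (expR + cst 1 : R -> R) (expR x) by apply: is_derive_eq;
      rewrite addr0.
    by [].
  by apply: is_derive_eq; rewrite /df /GRing.scale /=; ring.
have X0lt : 0 < X by rewrite lt0r Xn0.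
have [|z] := MVT X0lt (fun x _ => derf x).
  by apply: derivable_within_continuous => x _; have [] := derf x.
rewrite in_itv /= => /andP[z0 zX]; rewrite subr0 => fE.
have : 0 <= f X - f 0.
  rewrite fE mulr_ge0 // /df.
  have e0 := expR_gt0 z.
  have ez : z <= expR z - 1 by have := expR_ge1Dx z; lra.
  have eM : expR z <= expR X0 by rewrite ler_expR; lra.
  have p0 : 0 < (expR z + 1) ^+ 2 by rewrite exprn_gt0 // addr_gt0.
  have -> : 2^-1 - c * (3 * z ^+ 2) - 2 * (expR z / (expR z + 1) ^+ 2)
     = ((expR z - 1) ^+ 2 / (expR z + 1) ^+ 2 - z ^+ 2 / (expR X0 + 1) ^+ 2) / 2.
    by rewrite /c; field; rewrite !gt_eqF ?addr_gt0 ?expR_gt0.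
  rewrite divr_ge0 // subr_ge0; apply: ler_pM.
  - exact: sqr_ge0.
  - by rewrite invr_ge0 sqr_ge0.
  - by rewrite ler_pXn2r ?nnegrE //; lra.
  - by rewrite lef_pV2 ?posrE ?exprn_gt0 ?addr_gt0 ?expR_gt0 // ler_pXn2r ?nnegrE //; lra.
rewrite /f /cst /= !fctE /= /GRing.scale /= expR0 => h.
move: h; rewrite -/c mulr0 expr0n mulr0 (_ : 2 / (1 + 1) = 1 :> R); last by field.
by rewrite /= [X ^+ 3 * c]mulrC; lra.
Qed.

End BiasFunction.

(** The drift at mean spin [s], up to a factor between 1/2 and 1. The parameter [q] stands for
    [expR (2 * (beta / n))] and records that a spin does not act on itself. *)
Definition bias (R : realType) (beta q s : R) : R := bias_ratio q (2 * (beta * s)) - s.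

(** * Size of the drift near zero and in terms of the bias *)

Section Drift.
Variable R : realType.
Implicit Types (beta q s k delta M X : R).

Lemma drift_bias (n : nat) beta k : (0 < n)%N -> 0 <= beta ->
  exists2 kap : R, 2^-1 <= kap <= 1 &
    up_rate n beta k - down_rate n beta k
      = kap * bias beta (expR (2 * (beta / n%:R))) (k / n%:R).
Proof.
move=> n0 beta0; rewrite /up_rate /down_rate /bias /bias_ratio !p_plus_logistic.
have n0' : n%:R != 0 :> R by rewrite pnatr_eq0 -lt0n.
have -> : 2 * (beta * ((k + 1) / n%:R)) = 2 * (beta * (k / n%:R)) + 2 * (beta / n%:R) by
  field.
have -> : 2 * (beta * ((k - 1) / n%:R)) = 2 * (beta * (k / n%:R)) - 2 * (beta / n%:R) by
  field.
rewrite !expRD expRN.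
have q1 : 1 <= expR (2 * (beta / n%:R)).
  by rewrite -[leLHS]expR0 ler_expR !mulr_ge0 ?invr_ge0.
have y0 := expR_gt0 (2 * (beta * (k / n%:R))).
have main (q y : R) : 1 <= q -> 0 < y -> exists2 kap : R, 2^-1 <= kap <= 1 &
  (n%:R - k) / (2 * n%:R) * (y * q / (1 + y * q)) -
  (n%:R + k) / (2 * n%:R) * (1 - y / q / (1 + y / q)) =
  kap * ((y ^+ 2 - 1) / (y ^+ 2 + 2 * q * y + 1) - k / n%:R).
  move=> {}q1 {}y0; have q0 : 0 < q by lra.
  have yq : 0 < y * q by rewrite mulr_gt0.
  have qq : 0 < q ^+ 2 by rewrite exprn_gt0.
  have yy : 0 < y ^+ 2 by rewrite exprn_gt0.
  have qyy : 0 < q * y ^+ 2 by rewrite mulr_gt0.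
  have qqy : q * y <= q ^+ 2 * y by rewrite expr2 -mulrA ler_peMl // mulr_ge0 // ltW.
  have yqqy : y <= q ^+ 2 * y by rewrite ler_peMl ?(ltW y0) // exprn_ege1.
  have qqy0 : 0 < q ^+ 2 * y by rewrite mulr_gt0.
  have den : 0 < q * (y ^+ 2 + 1) + (1 + q ^+ 2) * y by lra.
  exists (q * (y ^+ 2 + 1 + 2 * q * y) / (2 * (q * (y ^+ 2 + 1) + (1 + q ^+ 2) * y))).
    by rewrite ler_pdivlMr ?ler_pdivrMr ?mulr_gt0 //; apply/andP; split; lra.
  have a1 : 1 + y * q != 0 by rewrite gt_eqF //; lra.
  have a2 : q + y != 0 by rewrite gt_eqF //; lra.
  have a3 : y ^+ 2 + 2 * q * y + 1 != 0 by rewrite gt_eqF //; lra.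
  by field; rewrite n0' a1 a2 a3 !gt_eqF.
exact: main.
Qed.

Lemma exp_sum_le X : 0 <= X -> X <= 4^-1 -> expR X + expR (- X) <= 2 + 3 * X ^+ 2.
Proof.
move=> X0 X1; have h1 := expR_ge1Dx X; have := expR_ge1Dx (- X); rewrite expRN.
have e0 := expR_gt0 X;
  have main (y : R) : 0 < y -> 1 + X <= y -> 1 - X <= y^-1 -> y + y^-1 <= 2 + 3 * X ^+ 2.
  move=> y0 y1 y2.
  have b1 : y <= (1 - X)^-1 by rewrite -[y]invrK lef_pV2 ?posrE ?invr_gt0 //; lra.
  have b2 : y^-1 <= (1 + X)^-1 by rewrite lef_pV2 ?posrE //; lra.
  apply: (le_trans (lerD b1 b2)).
  have p1 : 0 < 1 - X by lra. have p2 : 0 < 1 + X by lra.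
  rewrite (_ : (1 - X)^-1 + (1 + X)^-1 = 2 / ((1 - X) * (1 + X))); last by field;
    rewrite !gt_eqF.
  rewrite ler_pdivrMr ?mulr_gt0 //.
  have s0 := sqr_ge0 X.
  have s1 : X ^+ 2 <= 16^-1 by rewrite (_ : 16^-1 = 4^-1 ^+ 2);
    [rewrite ler_pXn2r ?nnegrE | field].
  have s2 : X ^+ 2 * X ^+ 2 <= X ^+ 2 * 16^-1 by rewrite ler_wpM2l.
  rewrite (_ : (2 + 3 * X ^+ 2) * ((1 - X) * (1 + X)) = 2 + X ^+ 2 - 3 * (X ^+ 2 * X ^+
    2)); last by ring.
  lra.
exact: main.
Qed.

Lemma bias_concave beta q a b c : 0 < beta -> 1 <= q -> q <= 2 -> 0 <= a -> a < b -> b <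
  c ->
  (bias beta q c - bias beta q b) * (b - a) <= (bias beta q b - bias beta q a) * (c - b).
Proof.
move=> beta0 q1 q2 a0 ab bc.
have lt2 s t : s < t -> 2 * (beta * s) < 2 * (beta * t) by move=> st;
  rewrite ltr_pM2l // ltr_pM2l.
have a0' : 0 <= 2 * (beta * a) by rewrite !mulr_ge0 // ltW.
have := bias_ratio_concave q1 q2 a0' (lt2 _ _ ab) (lt2 _ _ bc).
have e s t : 2 * (beta * s) - 2 * (beta * t) = (2 * beta) * (s - t) by ring.
by rewrite !e !(mulrCA _ (2 * beta)) ler_pM2l ?mulr_gt0 // /bias; lra.
Qed.

(** At a small multiple of [sqrt delta], the curvature of the ratio and the excess [q - 1] each cost
    only a small fraction of [delta] in the slope. So [2 (1 + delta)] times the slope is still at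
    least [1 + delta / 2] on the whole interval, and the mean value theorem applies. *)
Lemma bias_near_zero M delta q s1 : s1 = Num.sqrt delta / (8 * (1 + M) ^+ 2) ->
  0 < M -> 0 < delta -> delta <= M -> 1 <= q -> q <= 2 ->
  q - 1 <= delta / (8 * (1 + M)) ->
  delta / 2 * s1 <= bias (1 + delta) q s1.
Proof.
move=> s1E M0 d0 dM q1 q2 qd.
have M1 : 0 < 1 + M by lra.
have sd0 : 0 < Num.sqrt delta by rewrite sqrtr_gt0.
have sd2 : Num.sqrt delta ^+ 2 = delta by rewrite sqr_sqrtr // ltW.
have s10 : 0 < s1 by rewrite s1E divr_gt0 // mulr_gt0 ?exprn_gt0.
set X := 2 * ((1 + delta) * s1).
have X0 : 0 < X by rewrite !mulr_gt0 //; lra.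
have Xle : X <= Num.sqrt delta / (4 * (1 + M)).
  rewrite (_ : _ / (4 * _) = 2 * ((1 + M) * s1)); last first.
    by rewrite s1E; field; rewrite gt_eqF.
  by rewrite ler_pM2l // ler_pM2r //; lra.
have X2 : X ^+ 2 <= delta / (16 * (1 + M)).
  apply: (@le_trans _ _ ((Num.sqrt delta / (4 * (1 + M))) ^+ 2)).
    by rewrite ler_pXn2r ?nnegrE // ?(ltW X0) // (le_trans (ltW X0)).
  rewrite expr_div_n sd2 ler_pM2l // lef_pV2 ?posrE ?exprn_gt0 ?mulr_gt0 //.
  rewrite exprMn; have : 1 * (1 + M) <= (1 + M) * (1 + M) by rewrite ler_pM2r //; lra.
  rewrite -!expr2; lra.
have dM1 : delta / (1 + M) <= delta by rewrite ler_pdivrMr // ler_peMr; lra.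
have dM2 : delta / (1 + M) <= 1 by rewrite ler_pdivrMr //; lra.
have e16 : delta / (16 * (1 + M)) = delta / (1 + M) / 16 by field; rewrite gt_eqF.
have e8 : delta / (8 * (1 + M)) = delta / (1 + M) / 8 by field; rewrite gt_eqF.
rewrite e8 in qd; rewrite e16 in X2; set t := delta / (1 + M) in dM1 dM2 qd X2.
have X14 : X <= 4^-1.
  have : X ^+ 2 <= 4^-1 ^+ 2 by rewrite (_ : 4^-1 ^+ 2 = 1 / 16); [lra | field].
  by rewrite ler_pXn2r ?nnegrE // ltW.
have [u /andP[u0 uX] Xe] := bias_MVT q1 X0.
rewrite /bias -/X; rewrite bias_ratio0 !subr0 in Xe; rewrite Xe.
have slX := bias_slope_nincr q1 q2 (ltW u0) (ltW uX).
have cX := exp_sum_le (ltW X0) X14; have c2 := exp_sum_ge2 X.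
have : (1 + delta / 2) / (2 * (1 + delta)) <= bias_slope q X.
  rewrite /bias_slope; have main (c : R) : 2 <= c -> c <= 2 + 3 * X ^+ 2 ->
     (1 + delta / 2) / (2 * (1 + delta)) <= 2 * (q * c + 2) / (c + 2 * q) ^+ 2.
    move=> {}c2 cle.
    have den : 0 < c + 2 * q by lra.
    apply: (@le_trans _ _ (2 / (c + 2 * q))); last first.
      rewrite ler_pdivrMr // mulrAC ler_pdivlMr ?exprn_gt0 // expr2.
      have key : c + 2 * q <= q * c + 2.
        have : 0 <= (q - 1) * (c - 2) by rewrite mulr_ge0 //; lra.
        lra.
      by have := ler_wpM2r (ltW den) key; lra.
    rewrite ler_pdivrMr; last by lra.
    rewrite mulrAC ler_pdivlMr // .
    have cd : c + 2 * q <= 4 + t / 2 by lra.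
    have td : t * delta <= 1 * delta by rewrite ler_pM2r.
    apply: (@le_trans _ _ ((1 + delta / 2) * (4 + t / 2))).
      by rewrite ler_pM2l //; lra.
    lra.
  exact: main.
move=> sl; have {}sl := le_trans sl slX.
have : (1 + delta / 2) / (2 * (1 + delta)) * X <= bias_slope q u * X by rewrite ler_pM2r.
rewrite (_ : _ / _ * X = s1 + delta / 2 * s1); first by lra.
by rewrite /X; field; rewrite gt_eqF //; lra.
Qed.

(** The cubic term confines the positive zero of the bias to order [sqrt delta]; dropping it leaves
    the linear bound used near 0. *)
Lemma bias_le M delta q s : 0 < M -> 0 < delta -> delta <= M -> 1 <= q -> 0 <= s -> s <=
  1 ->
  bias (1 + delta) q s <= (delta - s ^+ 2 / (expR (2 * (1 + M)) + 1) ^+ 2) * s.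
Proof.
move=> M0 d0 dM q1 s0 s1; rewrite /bias.
have X0 : 0 <= 2 * ((1 + delta) * s) by rewrite !mulr_ge0 //; lra.
have XM : 2 * ((1 + delta) * s) <= 2 * (1 + M).
  rewrite ler_pM2l // -[leRHS]mulr1 ler_pM //; lra.
have := bias_ratio_le q1 X0 XM; set E := (expR _ + 1) ^+ 2.
have E0 : 0 < E by rewrite exprn_gt0 // addr_gt0 ?expR_gt0.
rewrite (_ : (2 * ((1 + delta) * s)) ^+ 3 / (6 * E) = (4 / 3 * (1 + delta) ^+ 3) * (s ^+
  3 / E)); last by field; rewrite gt_eqF.
have s3 : 0 <= s ^+ 3 / E by rewrite divr_ge0 ?exprn_ge0 // ltW.
have : 1 * (s ^+ 3 / E) <= (4 / 3 * (1 + delta) ^+ 3) * (s ^+ 3 / E).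
  rewrite ler_wpM2r // (@le_trans _ _ ((1 + delta) ^+ 3)) //.
    by rewrite exprn_ege1 //; lra.
  have : 0 <= (1 + delta) ^+ 3 by rewrite exprn_ge0 //; lra.
  lra.
rewrite (_ : (delta - _) * s = delta * s - s ^+ 3 / E); last by field; rewrite gt_eqF.
lra.
Qed.

End Drift.

(** * Shape of the bias on the unit interval *)

Section BiasProfile.
Variable R : realType.
Implicit Types (beta q s k delta M X gamma : R).

Lemma bias_root beta q s1 : 0 < beta -> 1 <= q -> 0 <= s1 -> s1 <= 1 -> 0 <= bias beta q
  s1 ->
  exists2 sc, s1 <= sc <= 1 & bias beta q sc = 0.
Proof.
move=> beta0 q1 s0 s1le b1.
have b20 : 0 < 2 * beta by rewrite mulr_gt0.
pose f := (@bias_ratio R q - (2 * beta)^-1 \*: id : R -> R).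
have fE s : f (2 * (beta * s)) = bias beta q s.
  by rewrite /f /bias !fctE /= /GRing.scale /= [2 * (beta * s)]mulrA mulKf // gt_eqF.
have der (x : R) : is_derive x 1 f (bias_slope q x - (2 * beta)^-1).
  have dr := is_derive_bias_ratio q1 x.
  by apply: is_derive_eq; rewrite /GRing.scale /= mulr1.
have le12 : 2 * (beta * s1) <= 2 * (beta * 1) by rewrite ler_pM2l // ler_pM2l.
have cont : {within `[2 * (beta * s1), 2 * (beta * 1)], continuous f}.
  by apply: derivable_within_continuous => x _; have [] := der x.
have bias1 : bias beta q 1 <= 0.
  rewrite /bias subr_le0 /bias_ratio ler_pdivrMr ?bias_den_gt0 // mul1r.
  have := expR_gt0 (2 * (beta * 1)); move: (expR _) => y y0.
  have : 0 <= q * y by rewrite mulr_ge0 // ?ltW //; lra.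
  lra.
have [|c] := IVT le12 cont (v := 0).
- rewrite !fE ge_min bias1 orbT /= le_max b1; exact: isT.
rewrite in_itv /= => /andP[c1 c2] fc; exists (c / (2 * beta)).
  by rewrite ler_pdivlMr // ler_pdivrMr //; apply/andP; split; lra.
by rewrite -fE -fc; congr f; field; rewrite gt_eqF.
Qed.

(** The bias is concave, vanishes at 0 and [sc], and is at least [delta / 2 * s1] at a point [s1]
    between them. Hence it lies above a tent up to [sc] and below a decreasing line afterwards. As
    [s1] and [sc] are both of order [sqrt delta], the slopes are of order [delta], uniformly for
    [delta <= M]. *)
Lemma bias_profile M : 0 < M ->
  exists gamma kap : R, [/\ 0 < gamma, gamma <= 1, 0 < kap & forall delta q,
    0 < delta -> delta <= M -> 1 <= q -> q <= 2 -> q - 1 <= delta / (8 * (1 + M)) ->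
    exists sc, [/\ kap * Num.sqrt delta <= sc, sc <= 1,
      forall s, 0 <= s -> s <= sc ->
        gamma * delta * Num.min s (sc - s) <= bias (1 + delta) q s &
      forall s, sc <= s -> s <= 1 ->
        bias (1 + delta) q s <= - (gamma * delta * (s - sc))]].
Proof.
move=> M0; have M1 : 0 < 1 + M by lra.
set e := expR (2 * (1 + M)) + 1; have e0 : 0 < e by rewrite addr_gt0 ?expR_gt0.
have e1 : 1 <= e by rewrite lerDr ltW ?expR_gt0.
pose a := 8 * (1 + M) ^+ 2.
have a0 : 0 < a by rewrite mulr_gt0 ?exprn_gt0.
have a1 : 1 <= a.
  have : 1 <= (1 + M) ^+ 2 by rewrite exprn_ege1 //; lra.
  rewrite /a; lra.
have ae0 : 0 < a * e by rewrite mulr_gt0.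
have ae1 : 1 <= a * e by rewrite mulr_ege1.
(* Here [s1] will be [sqrt delta / a] and [sc] at most [e * sqrt delta], so [s1] is at least
   [sc / (a * e)]. *)
exists (2^-1 / (a * e)), a^-1; split.
- by rewrite divr_gt0.
- by rewrite ler_pdivrMr //; lra.
- by rewrite invr_gt0.
move=> delta q d0 dM q1 q2 qd.
pose s1 := Num.sqrt delta / a.
have sd0 : 0 < Num.sqrt delta by rewrite sqrtr_gt0.
have sd2 : Num.sqrt delta ^+ 2 = delta by rewrite sqr_sqrtr // ltW.
have s10 : 0 < s1 by rewrite divr_gt0.
have b1 := bias_near_zero (erefl s1) M0 d0 dM q1 q2 qd.
have d1 : 0 < 1 + delta by lra.
have b1pos : 0 < bias (1 + delta) q s1 by apply: lt_le_trans b1; apply: mulr_gt0 s10;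
  rewrite divr_gt0.
have s11 : s1 <= 1.
  rewrite ler_pdivrMr // mul1r -(ler_pXn2r (isT : (0 < 2)%N)) ?nnegrE ?(ltW sd0) ?(ltW
    a0) // sd2.
  have : a <= a ^+ 2 by rewrite expr2 ler_peMr // ltW.
  have : (1 + M) <= (1 + M) ^+ 2 by rewrite expr2 ler_peMr //; lra.
  rewrite {1}/a; lra.
have [sc /andP[s1c sc1] bsc] := bias_root d1 q1 (ltW s10) s11 (ltW b1pos).
have s1lt : s1 < sc.
  by rewrite lt_neqAle s1c andbT; apply: contraTneq b1pos => ->; rewrite bsc ltxx.
have sc0 : 0 < sc by lra.
have sc_le : sc <= Num.sqrt delta * e.
  have := bias_le M0 d0 dM q1 (ltW sc0) sc1; rewrite bsc pmulr_lge0 // subr_ge0.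
  rewrite ler_pdivrMr ?exprn_gt0 // => h.
  rewrite -(ler_pXn2r (isT : (0 < 2)%N)) ?nnegrE ?mulr_ge0 ?(ltW sc0) ?(ltW sd0) ?(ltW
    e0) //.
  by rewrite exprMn sd2.
have ratio : sc / (a * e) <= s1.
  rewrite ler_pdivrMr // /s1 mulrA divfK ?gt_eqF //.
have b1' : delta / 2 / (a * e) * sc <= bias (1 + delta) q s1.
  apply: le_trans b1; rewrite -mulrA ler_pM2l; last by lra.
  by rewrite mulrC.
have g2 : 2^-1 / (a * e) * delta = delta / 2 / (a * e) by field; rewrite !gt_eqF.
have g0 : 0 < delta / 2 / (a * e) by rewrite divr_gt0 //; lra.
have gd : delta / 2 / (a * e) <= delta / 2 by rewrite ler_pdivrMr // ler_peMr //; lra.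
exists sc; split=> //.
- by rewrite mulrC.
- move=> s s0 ssc; rewrite g2; set g := delta / 2 / (a * e) in b1' g0 gd *.
  have bias0 : bias (1 + delta) q 0 = 0 by rewrite /bias !mulr0 bias_ratio0 subrr.
  (* Compare with the chord from 0 to [s1], then with the chord from [s1] to [sc]. *)
  have [ss1|s1s] := leP s s1.
    apply: (@le_trans _ _ (delta / 2 * s)).
      apply: (@le_trans _ _ (g * s)); last by rewrite ler_wpM2r.
      by rewrite ler_pM2l // ge_min lexx.
    have [->|sn0] := eqVneq s 0; first by rewrite mulr0 bias0.
    have [->//|sns1] := eqVneq s s1.
    have sp : 0 < s by rewrite lt0r sn0.
    have slt : s < s1 by rewrite lt_neqAle sns1.
    have := bias_concave d1 q1 q2 (lexx 0) sp slt; rewrite bias0 !subr0 => conc.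
    rewrite -(ler_pM2r s10); apply: (@le_trans _ _ (bias (1 + delta) q s1 * s));
      last by lra.
    by rewrite mulrAC ler_pM2r.
  have [->|snc] := eqVneq s sc; first by rewrite bsc subrr (min_idPr _) ?mulr0 // ltW.
  have slt : s < sc by rewrite lt_neqAle snc.
  have := bias_concave d1 q1 q2 (ltW s10) s1s slt; rewrite bsc => conc.
  apply: (@le_trans _ _ (g * (sc - s))); first by rewrite ler_pM2l // ge_min lexx orbT.
  rewrite -(ler_pM2r sc0); apply: (@le_trans _ _ (bias (1 + delta) q s1 * (sc - s))).
    by rewrite mulrAC ler_pM2r // subr_gt0.
  have h : bias (1 + delta) q s1 * (sc - s) <= bias (1 + delta) q s * (sc - s1) by lra.
  have h0 : 0 <= bias (1 + delta) q s.
    rewrite -(pmulr_lge0 _ (_ : 0 < sc - s1)) ?subr_gt0 //; apply: le_trans h.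
    by rewrite mulr_ge0 //; lra.
  apply: (le_trans h); rewrite ler_wpM2l //; lra.
- move=> s scs s1'; rewrite g2; set g := delta / 2 / (a * e) in b1' g0 gd *.
  have [->|snc] := eqVneq s sc; first by rewrite bsc subrr mulr0 oppr0.
  have slt : sc < s by rewrite lt_neqAle eq_sym snc.
  (* Past [sc] the graph stays below the line through its points at [s1] and [sc]. *)
  have := bias_concave d1 q1 q2 (ltW s10) s1lt slt; rewrite bsc subr0 sub0r mulNr => conc.
  rewrite -(ler_pM2r sc0);
    apply: (@le_trans _ _ (- (bias (1 + delta) q s1 * (s - sc)))); last first.
    by rewrite mulNr lerN2 mulrAC ler_pM2r // subr_gt0.
  have h0 : bias (1 + delta) q s <= 0.
    rewrite -(pmulr_lle0 _ (_ : 0 < sc - s1)) ?subr_gt0 //; apply: (le_trans conc).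
    by rewrite oppr_le0 mulr_ge0 //; lra.
  apply: le_trans conc; rewrite ler_wnM2l //; lra.
Qed.

End BiasProfile.

(** * Lower bound on the gap *)

Section Supersolutions.
Variable R : realType.
Implicit Types (u d k a g c theta : R).

(** For [6 k^2 <= a] the second-order term alone has the right sign and size. For larger [k] it may
    lose up to [12 k^2], but [g * a = 6] makes the drift term at least [24 k^2], and the remaining
    half of it pays for the rate [g / 96]. *)
Lemma inverse_quadratic_super u d k a g : 0 < g -> g * a = 6 -> 8 <= a -> 0 <= k ->
  0 <= u + d -> u + d <= 1 -> g * k <= u - d -> (6 * k ^+ 2 <= a -> 8^-1 <= u + d) ->
  u * (((k + 2) ^+ 2 + a)^-1 - (k ^+ 2 + a)^-1) + d * (((k - 2) ^+ 2 + a)^-1 - (k ^+ 2 +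
    a)^-1)
    <= - (g / 96) * (k ^+ 2 + a)^-1.
Proof.
move=> g0 ga a8 k0 ud0 ud1 gk small.
have k2 := sqr_ge0 k; have kp2 := sqr_ge0 (k + 2); have km2 := sqr_ge0 (k - 2).
have r0 : 0 < k ^+ 2 + a by lra.
have rp0 : 0 < (k + 2) ^+ 2 + a by lra.
have rm0 : 0 < (k - 2) ^+ 2 + a by lra.
pose br := 4 * (k * (u - d)) * (k ^+ 2 + a) + 4 * (u + d) * (a + 4 - 3 * k ^+ 2).
have -> : u * (((k + 2) ^+ 2 + a)^-1 - (k ^+ 2 + a)^-1) + d * (((k - 2) ^+ 2 + a)^-1 -
  (k ^+ 2 + a)^-1)
    = - (br / (((k + 2) ^+ 2 + a) * ((k - 2) ^+ 2 + a))) * (k ^+ 2 + a)^-1.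
  by rewrite /br; field; rewrite !gt_eqF.
rewrite ler_pM2r ?invr_gt0 // lerN2 ler_pdivlMr ?mulr_gt0 //.
have kD : k * (g * k) <= k * (u - d) by rewrite ler_wpM2l.
have kDr : k * (g * k) * (k ^+ 2 + a) <= k * (u - d) * (k ^+ 2 + a) by rewrite ler_wpM2r
  // ltW.
have rr : ((k + 2) ^+ 2 + a) * ((k - 2) ^+ 2 + a) <= (k ^+ 2 + a + 4) ^+ 2.
  rewrite (_ : _ * _ = (k ^+ 2 + a + 4) ^+ 2 - 16 * k ^+ 2); last by ring.
  by lra.
have [ka|ka] := leP (6 * k ^+ 2) a.
  have s8 := small ka.
  have R2 : (k ^+ 2 + a + 4) ^+ 2 <= (2 * a) ^+ 2 by rewrite ler_pXn2r ?nnegrE //; lra.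
  have b1 : 8^-1 * (a / 2) <= (u + d) * (a + 4 - 3 * k ^+ 2) by apply: ler_pM => //; lra.
  have b2 : 0 <= k * (g * k) * (k ^+ 2 + a) by rewrite !mulr_ge0 // ltW.
  have b3 : g / 96 * (((k + 2) ^+ 2 + a) * ((k - 2) ^+ 2 + a)) <= g / 96 * (2 * a) ^+ 2.
    by rewrite ler_wpM2l ?(le_trans rr) //; lra.
  have gaa : g * a * a = 6 * a by rewrite ga.
  apply: (le_trans b3); rewrite /br; lra.
set m := k ^+ 2 + a in r0 kDr rr *.
have gm : g * a <= g * m by rewrite ler_pM2l // /m; lra.
have gkm : k ^+ 2 * (g * a) <= k ^+ 2 * (g * m) by rewrite ler_wpM2l.
have s1 : 0 <= (u + d) * (a + 4) by rewrite mulr_ge0 //; lra.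
have s2 : (u + d) * k ^+ 2 <= 1 * k ^+ 2 by rewrite ler_wpM2r.
have m4 : (m + 4) ^+ 2 <= (3 / 2 * m) ^+ 2 by rewrite ler_pXn2r ?nnegrE // /m; lra.
have b3 : g / 96 * (((k + 2) ^+ 2 + a) * ((k - 2) ^+ 2 + a)) <= g / 96 * (3 / 2 * m) ^+ 2.
  by rewrite ler_wpM2l ?(le_trans rr) //; lra.
have gm0 : 0 < g * m by rewrite mulr_gt0.
have b4 : g * m * m <= g * m * (7 * k ^+ 2) by rewrite ler_pM2l // /m; lra.
have b5 : 0 <= g * m * k ^+ 2 by rewrite mulr_ge0 // ltW.
rewrite ga in gkm; apply: (le_trans b3); rewrite /br -/m; lra.
Qed.

(* Left of the well at [c]: [1 / (k^2 + a)] up to [theta = 3c/4], continued by the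
   linear function vanishing at [c]; the function decreases faster right of the
   joint, so that the kink at [theta] is concave. *)
Definition left_super a c k : R :=
  let theta := 3 / 4 * c in
  if `|k| <= theta then (k ^+ 2 + a)^-1
  else (c - `|k|) / ((theta ^+ 2 + a) * (c - theta)).

Lemma left_superN a c k : left_super a c (- k) = left_super a c k.
Proof. by rewrite /left_super normrN sqrrN. Qed.

Lemma left_super_gt0 a c k : 0 < a -> 0 < c -> `|k| < c -> 0 < left_super a c k.
Proof.
move=> a0 c0 kc; rewrite /left_super; case: ifP => _.
  by rewrite invr_gt0 ltr_wpDl ?sqr_ge0.
have c4 : 0 < c - 3 / 4 * c by lra.
by rewrite divr_gt0 ?subr_gt0 // mulr_gt0 // ltr_wpDl ?sqr_ge0.
Qed.

(** With [left_super_joint_left]: from 2 left of the joint onwards, [left_super] is the smaller of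
    its two branches, so after a jump across the joint either branch is an upper bound. The
    difference of the branches factors through [k - 3 / 4 * c]. *)
Lemma left_super_joint_right a c k : 0 < a -> 12 <= c -> 3 / 4 * c <= k ->
  (c - k) / (((3 / 4 * c) ^+ 2 + a) * (c - 3 / 4 * c)) <= (k ^+ 2 + a)^-1.
Proof.
move=> a0 c12 ck; have k2 := sqr_ge0 k; have t2 := sqr_ge0 (3 / 4 * c).
have c4 : 0 < c - 3 / 4 * c by lra.
have ta : 0 < (3 / 4 * c) ^+ 2 + a by rewrite ltr_wpDl.
rewrite ler_pdivrMr ?mulr_gt0 //.
rewrite mulrC ler_pdivlMr ?ltr_wpDl // -subr_ge0.
rewrite [leRHS](_ : _ = (k - 3 / 4 * c) * ((k ^+ 2 + a) - (c / 4) * (3 / 4 * c + k)));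
  last by field.
rewrite mulr_ge0 //; first by lra.
have : (c / 4) * (3 / 4 * c + k) <= (k / 3) * (k + k) by apply: ler_pM; lra.
lra.
Qed.

Lemma left_super_joint_left a c k : 0 < a -> 12 <= c -> 3 / 4 * c - 2 <= k -> k <= 3 / 4
  * c ->
  (k ^+ 2 + a)^-1 <= (c - k) / (((3 / 4 * c) ^+ 2 + a) * (c - 3 / 4 * c)).
Proof.
move=> a0 c12 ck kc; have k2 := sqr_ge0 k; have t2 := sqr_ge0 (3 / 4 * c).
have c4 : 0 < c - 3 / 4 * c by lra.
have ta : 0 < (3 / 4 * c) ^+ 2 + a by rewrite ltr_wpDl.
rewrite ler_pdivlMr ?mulr_gt0 //.
rewrite mulrC ler_pdivrMr ?ltr_wpDl // -subr_ge0.
rewrite [leRHS](_ : _ = (3 / 4 * c - k) * ((k ^+ 2 + a) - (c / 4) * (3 / 4 * c + k)));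
  last by field.
rewrite mulr_ge0 //; first by lra.
have : (c / 4) * (3 / 4 * c + k) <= ((k + 2) / 3) * (k + 2 + k) by apply: ler_pM; lra.
have : 0 <= (k - 7) * (k + 1) by rewrite mulr_ge0 //; lra.
lra.
Qed.

Lemma left_super_generator (n : nat) beta a c g eps k :
  0 <= up_rate n beta k -> 0 <= down_rate n beta k ->
  up_rate n beta k + down_rate n beta k <= 1 ->
  0 < g -> g * a = 6 -> 8 <= a -> 12 <= c -> eps <= g / 96 -> 0 <= k -> k + 2 <= c ->
  (k <= 3 / 4 * c -> g * k <= up_rate n beta k - down_rate n beta k) ->
  (3 / 4 * c <= k -> eps / 2 * (c - k) <= up_rate n beta k - down_rate n beta k) ->
  (6 * k ^+ 2 <= a -> 8^-1 <= up_rate n beta k + down_rate n beta k) ->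
  generator n beta (left_super a c) k <= - eps * left_super a c k.
Proof.
rewrite /generator; set u := up_rate n beta k; set d := down_rate n beta k.
move=> u0 d0 ud g0 ga a8 c12 epsg k0 kc near far small.
have a0 : 0 < a by lra. have c0 : 0 < c by lra.
have [kt|tk] := leP k (3 / 4 * c).
  have Ek : left_super a c k = (k ^+ 2 + a)^-1 by rewrite /left_super ger0_norm // kt.
  have Em : left_super a c (k - 2) = ((k - 2) ^+ 2 + a)^-1.
    rewrite /left_super ifT // ler_norml; apply/andP; split; lra.
  have Ep : left_super a c (k + 2) <= ((k + 2) ^+ 2 + a)^-1.
    rewrite /left_super ger0_norm; last by lra.
    by case: ifPn => //; rewrite -ltNge => /ltW ?; exact: left_super_joint_right.
  have := inverse_quadratic_super g0 ga a8 k0 (addr_ge0 u0 d0) ud (near kt) small.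
  have : u * left_super a c (k + 2) <= u * ((k + 2) ^+ 2 + a)^-1 by rewrite ler_wpM2l.
  have r0 : 0 < (k ^+ 2 + a)^-1 by rewrite invr_gt0 ltr_wpDl ?sqr_ge0.
  have : eps * (k ^+ 2 + a)^-1 <= g / 96 * (k ^+ 2 + a)^-1 by rewrite ler_pM2r.
  rewrite Ek Em; lra.
(* On the linear branch the second-order part cancels and the generator is at most
   [- 2 (u - d) La]. *)
set La := (((3 / 4 * c) ^+ 2 + a) * (c - 3 / 4 * c))^-1.
have c4 : 0 < c - 3 / 4 * c by lra.
have La0 : 0 < La by rewrite invr_gt0 mulr_gt0 // ltr_wpDl ?sqr_ge0.
have Ek : left_super a c k = (c - k) * La.
  by rewrite /left_super ger0_norm // ifF //; apply/negbTE; rewrite -ltNge.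
have Ep : left_super a c (k + 2) = (c - (k + 2)) * La.
  rewrite /left_super ger0_norm; last by lra.
  by rewrite ifF //; apply/negbTE; rewrite -ltNge; lra.
have Em : left_super a c (k - 2) <= (c - (k - 2)) * La.
  rewrite /left_super ger0_norm; last by lra.
  by case: ifPn => // ?; apply: left_super_joint_left => //; lra.
have : d * left_super a c (k - 2) <= d * ((c - (k - 2)) * La) by rewrite ler_wpM2l.
have : eps / 2 * (c - k) * La <= (u - d) * La by rewrite ler_pM2r // far // ltW.
rewrite Ek Ep; lra.
Qed.

End Supersolutions.

(** * Uniform bound on even eigenfunctions of mean zero *)

Section EigenvalueBound.
Variable R : realType.
Implicit Types (n : nat) (beta k delta M : R).

Lemma up_rate_ge0 n beta k : (0 < n)%N -> k <= n%:R -> 0 <= up_rate n beta k.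
Proof.
move=> n0 kn; rewrite /up_rate mulr_ge0 ?(ltW (p_plus_gt0 _ _)) //.
by rewrite divr_ge0 ?mulr_ge0 // subr_ge0.
Qed.

Lemma down_rate_ge0 n beta k : (0 < n)%N -> - n%:R <= k -> 0 <= down_rate n beta k.
Proof. by move=> n0 kn; rewrite -up_rateN up_rate_ge0 // lerNl. Qed.

Lemma rates_le1 n beta k : (0 < n)%N -> - n%:R <= k -> k <= n%:R ->
  up_rate n beta k + down_rate n beta k <= 1.
Proof.
move=> n0 kn1 kn2; have N0 : 0 < n%:R :> R by rewrite ltr0n.
have a1 : 0 <= (n%:R - k) / (2 * n%:R) by rewrite divr_ge0 ?mulr_ge0 // subr_ge0.
have a2 : 0 <= (n%:R + k) / (2 * n%:R) by rewrite divr_ge0 ?mulr_ge0 // -lerBlDl sub0r.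
have : up_rate n beta k <= (n%:R - k) / (2 * n%:R).
  by rewrite /up_rate ler_piMr // ltW ?p_plus_lt1.
have : down_rate n beta k <= (n%:R + k) / (2 * n%:R).
  by rewrite /down_rate ler_piMr // gerBl ltW ?p_plus_gt0.
have : (n%:R - k) / (2 * n%:R) + (n%:R + k) / (2 * n%:R) = 1 by field; rewrite gt_eqF.
lra.
Qed.

Lemma p_plus_ge_half beta (s : R) : 0 <= beta -> 0 <= s -> 2^-1 <= p_plus beta s.
Proof.
move=> b0 s0; have : p_plus beta (- s) <= p_plus beta s by apply: p_plus_homo => //; lra.
rewrite p_plusN; lra.
Qed.

Lemma up_rate_ge n beta k : (0 < n)%N -> 0 <= beta -> 0 <= k -> 2 * k <= n%:R ->
  8^-1 <= up_rate n beta k.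
Proof.
move=> n0 b0 k0 kn; have N0 : 0 < n%:R :> R by rewrite ltr0n.
have h1 : 2^-1 <= p_plus beta ((k + 1) / n%:R).
  by apply: p_plus_ge_half => //; rewrite divr_ge0 //; lra.
have h2 : 4^-1 <= (n%:R - k) / (2 * n%:R) by rewrite ler_pdivlMr ?mulr_gt0 //; lra.
rewrite (_ : 8^-1 = 4^-1 * 2^-1); last by field.
by apply: ler_pM => //; lra.
Qed.

Lemma exp_le_linear (x : R) : 0 <= x -> x <= 2^-1 -> expR x <= 1 + 2 * x.
Proof.
move=> x0 x1; have := expR_ge1Dx (- x); rewrite expRN => h.
have e0 := expR_gt0 x.
have h2 : expR x * (1 - x) <= 1.
  have := ler_wpM2l (ltW e0) h; rewrite mulfV ?gt_eqF //; lra.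
have h3 : 1 <= (1 + 2 * x) * (1 - x).
  have : 0 <= x * (1 - 2 * x) by rewrite mulr_ge0 //; lra.
  lra.
by rewrite -(@ler_pM2r _ (1 - x)) ?(le_trans h2) //; lra.
Qed.

(** [q - 1] is of order [1 / n], which is small against [delta] once [delta * n] is large. *)
Lemma field_factor_bounds M n delta : 0 < M -> 0 < delta -> delta <= M ->
  32 * (1 + M) ^+ 2 <= delta * n%:R ->
  let q := expR (2 * ((1 + delta) / n%:R)) in
  [/\ (0 < n)%N, 32 * (1 + M) <= n%:R :> R, 1 <= q, q <= 2 & q - 1 <= delta / (8 * (1 +
    M))].
Proof.
move=> M0 d0 dM dn q.
have M1 : 0 < 1 + M by lra.
have M2 : 0 < (1 + M) ^+ 2 by rewrite exprn_gt0.
have n0 : (0 < n)%N.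
  by rewrite lt0n; apply: contraTneq dn => ->; rewrite mulr0 -ltNge; lra.
have N0 : 0 < n%:R :> R by rewrite ltr0n.
have Nb : 32 * (1 + M) <= n%:R.
  have h : delta * n%:R <= (1 + M) * n%:R by rewrite ler_pM2r //; lra.
  by rewrite -(ler_pM2l M1) (le_trans _ h) // (le_trans _ dn) // expr2; lra.
set x := 2 * ((1 + delta) / n%:R).
have x0 : 0 <= x by rewrite mulr_ge0 // divr_ge0 //; lra.
have xle : x <= 2 * (1 + M) / n%:R.
  by rewrite /x mulrA ler_pM2r ?invr_gt0 //; lra.
have x2 : 2 * (1 + M) / n%:R <= 16^-1 by rewrite ler_pdivrMr //; lra.
have x3 : 4 * (1 + M) / n%:R <= delta / (8 * (1 + M)).
  rewrite ler_pdivrMr // mulrAC ler_pdivlMr ?mulr_gt0 //.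
  by rewrite (le_trans _ dn) // expr2; lra.
have xx : x <= 2^-1 by lra.
have qle := exp_le_linear x0 xx.
split=> //.
- by rewrite -[leLHS]expR0 ler_expR.
- rewrite /q -/x; lra.
- rewrite /q -/x.
  have : 2 * (2 * (1 + M) / n%:R) <= delta / (8 * (1 + M)).
    by rewrite (_ : 2 * _ = 4 * (1 + M) / n%:R) //; field; rewrite gt_eqF.
  lra.
Qed.

Lemma lattice_point n (t : R) : 0 <= t -> t <= n%:R -> exists (c : int) (x : config n),
  [/\ total_spin x = c, c%:~R - 1 <= t & t <= c%:~R + 1].
Proof.
(* The number of plus spins is [(t + n) / 2] rounded to the nearest integer. *)
move=> t0 tn; pose j := Num.truncn ((t + n%:R + 1) / 2).
have /truncn_itv : 0 <= (t + n%:R + 1) / 2 by rewrite divr_ge0 // !addr_ge0.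
rewrite -/j => /andP[j1 j2].
have jn : (j <= n)%N.
  by rewrite -ltnS -(ltr_nat R) (le_lt_trans j1) // -[ltRHS]natr1; lra.
have [x xE] := config_of_total_spin jn.
exists (j%:Z *+ 2 - n%:Z), x.
have -> : (j%:Z *+ 2 - n%:Z)%:~R = 2 * j%:R - n%:R :> R.
  by rewrite rmorphB rmorphMn /= -mulr_natl.
by rewrite -[ltRHS]natr1 in j2; split=> //; lra.
Qed.

(** [gm] stands for [gamma * delta / n]; taking [g = gm / 12] in [left_super_generator] dictates
    [a = 6 / g], of order [n / delta]. *)
Lemma left_well n beta (c m gm eps k : R) : (0 < n)%N -> 0 <= beta ->
  0 < gm -> gm <= 1 -> 20 <= m -> m <= n%:R -> c - 1 <= m -> m <= c + 1 ->
  eps <= gm / (12 * 96) -> 48 <= gm * n%:R ^+ 2 ->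
  (forall t, 0 <= t -> t <= k -> t <= m - k -> gm * t / 2 <= up_rate n beta k -
    down_rate n beta k) ->
  0 <= k -> k + 2 <= c ->
  generator n beta (left_super (6 / (gm / 12)) c) k <= - eps * left_super (6 / (gm /
    12)) c k.
Proof.
move=> n0 b0 gm0 gm1 m20 mn c1 c2 epsg gmn driftL k0 kc.
have N0 : 0 < n%:R :> R by rewrite ltr0n.
have kn : k <= n%:R by lra.
have nk : - n%:R <= k by lra.
have g0 : 0 < gm / 12 by rewrite divr_gt0.
have up0 := up_rate_ge0 beta n0 kn; have down0 := down_rate_ge0 beta n0 nk.
apply: (@left_super_generator _ n beta _ c (gm / 12) eps) => //.
- exact: rates_le1.
- by rewrite mulrC divfK // gt_eqF.
- by rewrite ler_pdivlMr //; clear driftL; lra.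
- by clear driftL; lra.
- by clear -epsg; lra.
(* Up to the joint, [k / 6] is below both [k] and the distance to [m]; the 6 and the 2 of [driftL]
   make the 12 in [g]. *)
- move=> kth; have := driftL (k / 6); clear driftL up0 down0 gmn.
  rewrite (_ : gm / 12 * k = gm * (k / 6) / 2); last by field.
  by apply; lra.
(* Here [c - k] is at least 2, so halving it absorbs the error 1 between [c] and [m]. *)
- move=> kth; have := driftL ((c - k) / 2) => dl.
  apply: (@le_trans _ _ (gm * ((c - k) / 2) / 2)); last first.
    by apply: dl; clear driftL up0 down0 gmn; lra.
  have ck : 0 <= c - k by clear -kc; lra.
  have h1 : eps * (c - k) <= gm / (12 * 96) * (c - k) by rewrite ler_wpM2r.
  have h2 : 0 <= gm * (c - k) by rewrite mulr_ge0 // ltW.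
  clear -h1 h2; lra.
(* In this range [gm * k^2 <= 12], and [48 <= gm * n^2] then gives [2 k <= n]. *)
- move=> ka; suff h : 8^-1 <= up_rate n beta k by clear -h down0; lra.
  apply: up_rate_ge => //.
  rewrite -(ler_pXn2r (isT : (0 < 2)%N)) ?nnegrE ?mulr_ge0 //.
  have ka' : gm * k ^+ 2 <= 12.
    by move: ka; rewrite ler_pdivlMr //; clear; lra.
  have h2 : gm * (2 * k) ^+ 2 <= gm * n%:R ^+ 2.
    apply: (le_trans _ gmn); rewrite exprMn; clear -ka'; lra.
  by rewrite ler_pM2l in h2.
Qed.

(** On these points the function is linear, so the generator is twice the drift; [k - m] is at least
    half of [k - c] because [k >= c + 2] and [m <= c + 1]. *)
Lemma right_well n beta (c m gm eps k : R) : 0 < gm -> 0 <= c -> m <= c + 1 ->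
  eps <= gm / (12 * 96) -> up_rate n beta k - down_rate n beta k <= - (gm * (k - m) / 2)
    ->
  c + 2 <= k ->
  generator n beta (fun t => `|t| - c) k <= - eps * (`|k| - c).
Proof.
move=> gm0 c0 mc epsg dR ck; rewrite /generator.
have k0 : 0 <= k by lra.
have kp : 0 <= k + 2 by lra.
have km : 0 <= k - 2 by lra.
rewrite (ger0_norm k0) (ger0_norm kp) (ger0_norm km).
have kc : 0 <= k - c by lra.
have h1 : gm * ((k - c) / 2) <= gm * (k - m) by rewrite ler_pM2l //; lra.
have h2 : eps * (k - c) <= gm / (12 * 96) * (k - c) by rewrite ler_wpM2r.
have h3 : 0 <= gm * (k - c) by rewrite mulr_ge0 // ltW.
move: dR; set u := up_rate _ _ _; set d := down_rate _ _ _ => dR.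
clear -h1 h2 h3 dR; lra.
Qed.

Lemma drift_profile n beta q sc gamma delta : (0 < n)%N -> 0 <= beta ->
  q = expR (2 * (beta / n%:R)) -> 0 < gamma -> 0 < delta ->
  (forall s, 0 <= s -> s <= sc -> gamma * delta * Num.min s (sc - s) <= bias beta q s) ->
  (forall s, sc <= s -> s <= 1 -> bias beta q s <= - (gamma * delta * (s - sc))) ->
  (forall k, 0 <= k -> k <= n%:R * sc -> forall t, 0 <= t -> t <= k -> t <= n%:R * sc -
    k ->
    gamma * (delta / n%:R) * t / 2 <= up_rate n beta k - down_rate n beta k) /\
  (forall k, n%:R * sc <= k -> k <= n%:R ->
    up_rate n beta k - down_rate n beta k <= - (gamma * (delta / n%:R) * (k - n%:R * sc)
      / 2)).
Proof.
move=> n0 b0 qE ga0 d0 scL scR; have N0 : 0 < n%:R :> R by rewrite ltr0n.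
have gd0 : 0 < gamma * delta by rewrite mulr_gt0.
split=> [k k0 ksc t t0 tk tsc|k ksc kn]; have [h /andP[h1 h2] ->] := drift_bias k n0 b0;
  rewrite -qE.
  have s0 : 0 <= k / n%:R by rewrite divr_ge0 // ltW.
  have ssc : k / n%:R <= sc by rewrite ler_pdivrMr // mulrC.
  have b1 := scL _ s0 ssc.
  have b2 : t / n%:R <= Num.min (k / n%:R) (sc - k / n%:R).
    rewrite le_min ler_pM2r ?invr_gt0 // tk /= ler_pdivrMr // mulrBl divfK ?gt_eqF //.
    by rewrite mulrC.
  have {}b1 : gamma * delta * (t / n%:R) <= bias beta q (k / n%:R).
    by apply: le_trans b1; rewrite ler_pM2l.
  have b3 : 0 <= gamma * delta * (t / n%:R) by rewrite mulr_ge0 ?(ltW gd0) // divr_ge0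
    // ltW.
  rewrite (_ : _ / 2 = 2^-1 * (gamma * delta * (t / n%:R))); last by field;
    rewrite gt_eqF.
  by apply: ler_pM.
have ssc : sc <= k / n%:R by rewrite ler_pdivlMr // mulrC.
have s1 : k / n%:R <= 1 by rewrite ler_pdivrMr // mul1r.
have b1 := scR _ ssc s1.
have b3 : 0 <= gamma * delta * (k / n%:R - sc) by rewrite mulr_ge0 ?(ltW gd0) ?subr_ge0.
have b4 : 2^-1 * (gamma * delta * (k / n%:R - sc)) <= h * - bias beta q (k / n%:R).
  by apply: ler_pM => //; rewrite lerNr.
rewrite (_ : _ * _ / 2 = 2^-1 * (gamma * delta * (k / n%:R - sc))); last by field;
  rewrite gt_eqF.
by rewrite mulrN lerNr in b4.
Qed.

Lemma even_eigenvalue_bound M : 0 < M -> exists e0 T : R, 0 < e0 /\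
  forall n delta, 0 < delta -> delta <= M ->
  T <= delta * n%:R -> T <= n%:R * Num.sqrt delta ->
  forall (F : config n -> R) lam y0, even_fun F ->
    \sum_x gibbs_weight (1 + delta) x * F x = 0 ->
    (forall x, glauber_op (1 + delta) F x = lam * F x) -> F y0 != 0 ->
    lam <= 1 - e0 * (delta / n%:R).
Proof.
move=> M0; have [gamma [kap [ga0 ga1 kap0 prof]]] := bias_profile M0.
have M1 : 0 < 1 + M by lra.
(* The terms of the threshold yield the hypothesis of [field_factor_bounds], [48 <= gm * n^2] and
   [20 <= n * sc]. The factor [1 + M] keeps the rate below [1 / n], as the case of broken symmetry
   requires. *)
exists (gamma / (12 * 96 * (1 + M))), (32 * (1 + M) ^+ 2 + 48 / gamma + 20 / kap).
split; first by rewrite divr_gt0 ?mulr_gt0.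
move=> n delta d0 dM T1 T2 F lam y0 eF mean0 GF Fy0.
have ga48 : 0 < 48 / gamma by rewrite divr_gt0.
have kap20 : 0 < 20 / kap by rewrite divr_gt0.
have MM : 0 < 32 * (1 + M) ^+ 2 by rewrite mulr_gt0 ?exprn_gt0.
have dn : 32 * (1 + M) ^+ 2 <= delta * n%:R by lra.
have gdn : 48 <= gamma * (delta * n%:R).
  have h : 48 / gamma <= delta * n%:R by lra.
  by rewrite ler_pdivrMr // mulrC in h.
have nsd : 20 <= n%:R * (kap * Num.sqrt delta).
  have h : 20 / kap <= n%:R * Num.sqrt delta by lra.
  by rewrite mulrCA mulrC -ler_pdivrMr.
clear T1 T2 ga48 kap20 MM.
have [n0 nM q1 q2 qd] := field_factor_bounds M0 d0 dM dn.
have N0 : 0 < n%:R :> R by rewrite ltr0n.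
have [sc [sckap sc1 scL scR]] := prof delta _ d0 dM q1 q2 qd.
have b0 : 0 <= 1 + delta by rewrite addr_ge0 // ltW.
have [driftL driftR] := drift_profile n0 b0 erefl ga0 d0 scL scR.
have m20 : 20 <= n%:R * sc by apply: (le_trans nsd); rewrite ler_pM2l.
have mn : n%:R * sc <= n%:R by rewrite ler_piMr // ltW.
set gm := gamma * (delta / n%:R) in driftL driftR.
have gm0 : 0 < gm by rewrite mulr_gt0 ?divr_gt0.
have gm1 : gm <= 1.
  rewrite -[leRHS]mulr1; apply: ler_pM => //;
    rewrite ?(ltW ga0) ?divr_ge0 ?(ltW d0) ?(ltW N0) //.
  by rewrite ler_pdivrMr // mul1r; clear -nM dM M0; lra.
have gmn : 48 <= gm * n%:R ^+ 2.
  by rewrite /gm (_ : _ * _ ^+ 2 = gamma * (delta * n%:R)) //; field; rewrite gt_eqF.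
set eps := gamma / _ * _.
have eps_le : eps <= gm / (12 * 96).
  rewrite /eps [leLHS]mulrAC -/gm (ler_pM2l gm0) lef_pV2 ?posrE ?mulr_gt0 //.
  by rewrite ler_peMr //; clear -M0; lra.
have [small_lam|big_lam] := leP `|lam| (1 - n%:R^-1).
  apply: (le_trans (ler_norm _)); apply: (le_trans small_lam); rewrite lerD2l lerN2.
  rewrite /eps mulrA -[leRHS]mul1r ler_pM2r ?invr_gt0 // mulrAC ler_pdivrMr ?mulr_gt0 //.
  have gdM : gamma * delta <= 1 * M by apply: ler_pM => //; exact: ltW.
  by clear -gdM M0; lra.
have tF := total_spin_invariant_eigenfunction b0 GF big_lam.
have m0 : 0 <= n%:R * sc by rewrite (le_trans _ m20).
have [c [xc [xcE c1 c2]]] := lattice_point m0 mn.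
clear prof scL scR sckap nsd dn gdn nM qd q1 q2 big_lam.
move: (n%:R * sc : R) m0 mn m20 driftL driftR c1 c2 => m m0 mn m20 driftL driftR c1 c2.
have c12 : 12 <= c%:~R :> R by clear -m20 c2; lra.
have cR : 0 < c%:~R :> R by rewrite (lt_le_trans _ c12).
have c0 : 0 < c by rewrite -(ltr0z R).
apply: (@eigenvalue_two_wells R n (1 + delta) n0 c (left_super (6 / (gm / 12)) c%:~R)
  (fun k => `|k| - c%:~R) eps lam F xc y0) => //.
- by move=> t; rewrite left_superN.
- by move=> t; rewrite normrN.
- rewrite /left_super (gtr0_norm cR).
  by rewrite ifF ?subrr ?mul0r //; apply/negbTE; rewrite -ltNge; clear -cR; lra.
- by rewrite (gtr0_norm cR) subrr.
- move=> k k0 kc.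
  have k0' : 0 <= k%:~R :> R by rewrite ler0z.
  have kc' : k%:~R + 2 <= c%:~R :> R by rewrite -(ler_int R) rmorphD in kc.
  split.
    apply: left_super_gt0 => //; first by rewrite !divr_gt0.
    by rewrite ger0_norm //; clear -kc'; lra.
  apply: (@left_well n _ c%:~R m gm) => //.
  by apply: driftL => //; clear -kc' c1; lra.
- move=> k ck kn.
  have ck' : c%:~R + 2 <= k%:~R :> R by rewrite -(ler_int R) rmorphD in ck.
  have kn' : k%:~R <= n%:R :> R by rewrite -(ler_int R) in kn.
  split; first by rewrite ger0_norm; clear -ck' cR; lra.
  apply: (@right_well n _ c%:~R m gm) => //; first exact: ltW.
  by apply: driftR => //; clear -ck' c2; lra.
Qed.

End EigenvalueBound.

(** * Upper bound on the gap *)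

Section Bumps.
Variable R : realType.
Implicit Types (n : nat) (u d t z W A beta k c delta M : R).

Definition pos_sq t : R := (Num.max t 0) ^+ 2.

Lemma pos_sq_ge0 t : 0 <= pos_sq t.
Proof. exact: sqr_ge0. Qed.

Lemma pos_sq_pos t : 0 <= t -> pos_sq t = t ^+ 2.
Proof. by move=> t0; rewrite /pos_sq (max_idPl _). Qed.

Lemma pos_sq_neg t : t <= 0 -> pos_sq t = 0.
Proof. by move=> t0; rewrite /pos_sq (max_idPr _) // expr0n. Qed.

Lemma pos_sq_convex t (s : R) : 0 <= t -> 2 * t * s <= pos_sq (t + s) - pos_sq t.
Proof.
move=> t0; rewrite (pos_sq_pos t0); have [ts|ts] := leP 0 (t + s).
  by rewrite pos_sq_pos //; have := sqr_ge0 s; lra.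
rewrite (pos_sq_neg (ltW ts)).
have h : t * (t + s) <= 0 by rewrite mulr_ge0_le0 // ltW.
by have := sqr_ge0 t; lra.
Qed.

(** Squaring the truncated parabola makes it continuously differentiable at its edges. *)
Definition bump W c k : R := pos_sq (W ^+ 2 - (k - c) ^+ 2).

Lemma bump_out W c k : 0 <= W -> W <= `|k - c| -> bump W c k = 0.
Proof.
move=> W0 kc; apply: pos_sq_neg; rewrite subr_le0 -[leRHS]real_normK ?num_real //.
by rewrite ler_pXn2r ?nnegrE.
Qed.

Lemma bump_in W c k : `|k - c| < W -> 0 < bump W c k.
Proof.
move=> kc; have W0 : 0 < W by apply: le_lt_trans kc.
have t0 : 0 < W ^+ 2 - (k - c) ^+ 2.
  by rewrite subr_gt0 -[ltLHS]real_normK ?num_real // ltr_pXn2r ?nnegrE // ltW.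
by rewrite /bump pos_sq_pos ?ltW // exprn_gt0.
Qed.

Lemma bump_ge0 W c k : 0 <= bump W c k.
Proof. exact: pos_sq_ge0. Qed.

Lemma bumpN W c k : bump W c (- k) = bump W (- c) k.
Proof. by rewrite /bump -opprD sqrrN opprK. Qed.

(* Near the edge of the bump the inward jump contributes its full second-order
   term, which absorbs the first-order terms. *)
Lemma bump_edge u d t z W A : 8 <= W -> 0 <= A -> 8^-1 <= u -> 8^-1 <= d -> u + d <= 1 ->
  `|u - d| * W <= A -> 0 < t -> t = W ^+ 2 - z ^+ 2 -> W / 2 <= z ->
  - (128 * (A + 1) ^+ 2 / W ^+ 2) * t ^+ 2 <=
  u * (pos_sq (t - (4 * z + 4)) - t ^+ 2) + d * (pos_sq (t + (4 * z - 4)) - t ^+ 2).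
Proof.
move=> W8 A0 u8 d8 ud DA t0 tE zW.
have W0 : 0 < W by lra.
have WW : 0 < W ^+ 2 by rewrite exprn_gt0.
have h1 : 2 * t * - (4 * z + 4) <= pos_sq (t - (4 * z + 4)) - t ^+ 2.
  by rewrite -[in leRHS](pos_sq_pos (ltW t0)); apply: pos_sq_convex; exact: ltW.
have h2 : pos_sq (t + (4 * z - 4)) - t ^+ 2 = 2 * t * (4 * z - 4) + (4 * z - 4) ^+ 2.
  by rewrite pos_sq_pos; [ring | clear -t0 zW W8; lra].
rewrite h2; have {}h1 := ler_wpM2l (_ : 0 <= u) h1.
have u0 : 0 <= u by clear -u8; lra.
have {}h1 := h1 u0.
have h3 : W ^+ 2 <= (4 * z - 4) ^+ 2.
  by rewrite ler_pXn2r ?nnegrE //; clear -zW W8; lra.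
have h4 : 8^-1 * W ^+ 2 <= d * (4 * z - 4) ^+ 2 by apply: ler_pM => //; rewrite ltW.
have zW1 : z <= W.
  by rewrite -(ler_pXn2r (isT : (0 < 2)%N)) ?nnegrE; clear -t0 tE zW W0; lra.
have z0 : 0 <= z by clear -zW W0; lra.
have zD : z * (u - d) <= A.
  apply: (le_trans (ler_norm _)); rewrite normrM (ger0_norm z0) mulrC.
  by apply: le_trans DA; rewrite ler_wpM2l.
have h5 : t * (z * (u - d) + (u + d)) <= t * (A + 1).
  by rewrite ler_pM2l // lerD.
set B := A + 1 in h5 *.
(* Completing the square: the gain [W^2 / 8] of the inward jump pays for the first-order loss
   [8 t B], which fixes the constant 128. *)
have h6 : 0 <= 128 * B ^+ 2 / W ^+ 2 * t ^+ 2 - 8 * (t * B) + 8^-1 * W ^+ 2.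
  rewrite (_ : _ + _ = 8^-1 * (32 * B * t / W - W) ^+ 2);
    first by rewrite mulr_ge0 ?sqr_ge0.
  by field; rewrite gt_eqF.
clear -h1 h4 h5 h6; lra.
Qed.

(** In the central half [t] is at least [3 / 4 * W^2], so the first-order terms, of size
    [t * (A + 1)], are absorbed by [t^2 / W^2]; the tangent bound suffices for both jumps. *)
Lemma bump_center u d t z W A : 8 <= W -> 0 <= A -> 0 <= u -> 0 <= d -> u + d <= 1 ->
  `|u - d| * W <= A -> t = W ^+ 2 - z ^+ 2 -> `|z| <= W / 2 ->
  - (128 * (A + 1) ^+ 2 / W ^+ 2) * t ^+ 2 <=
  u * (pos_sq (t - (4 * z + 4)) - t ^+ 2) + d * (pos_sq (t + (4 * z - 4)) - t ^+ 2).
Proof.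
move=> W8 A0 u0 d0 ud DA tE zW.
have W0 : 0 < W by lra.
have WW : 0 < W ^+ 2 by rewrite exprn_gt0.
have zz : z ^+ 2 <= W ^+ 2 / 4.
  rewrite (_ : W ^+ 2 / 4 = (W / 2) ^+ 2); last by field.
  by rewrite -[leLHS]real_normK ?num_real // ler_pXn2r ?nnegrE //; clear -W0; lra.
have t1 : 3 / 4 * W ^+ 2 <= t by clear -zz tE; lra.
have t0 : 0 <= t by clear -t1 WW; lra.
have h1 : 2 * t * - (4 * z + 4) <= pos_sq (t - (4 * z + 4)) - t ^+ 2.
  by rewrite -[in leRHS](pos_sq_pos t0); apply: pos_sq_convex.
have h2 : 2 * t * (4 * z - 4) <= pos_sq (t + (4 * z - 4)) - t ^+ 2.
  by rewrite -[in leRHS](pos_sq_pos t0); apply: pos_sq_convex.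
have {}h1 := ler_wpM2l u0 h1; have {}h2 := ler_wpM2l d0 h2.
have zD : z * (u - d) <= A.
  apply: (le_trans (ler_norm _)); rewrite normrM mulrC.
  apply: le_trans DA; rewrite ler_wpM2l // (le_trans zW) //; clear -W0; lra.
have h5 : t * (z * (u - d) + (u + d)) <= t * (A + 1).
  by rewrite ler_wpM2l // lerD.
set B := A + 1 in h5 *; have B1 : 1 <= B by rewrite /B; clear -A0; lra.
have h6 : 3 / 4 * t <= t ^+ 2 / W ^+ 2.
  by rewrite ler_pdivlMr //; have := ler_wpM2l t0 t1; clear; lra.
have h7 : B * (3 / 4 * t) <= B ^+ 2 * (t ^+ 2 / W ^+ 2).
  apply: ler_pM => //; [by clear -B1; lra | by clear -t0;
    lra | by rewrite expr2 ler_peMr //; clear -B1; lra].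
have h8 : 0 <= B ^+ 2 * (t ^+ 2 / W ^+ 2) by rewrite mulr_ge0 ?sqr_ge0 // divr_ge0
  ?sqr_ge0.
rewrite (_ : - _ * t ^+ 2 = - 128 * (B ^+ 2 * (t ^+ 2 / W ^+ 2))); last by field;
  rewrite gt_eqF.
clear -h1 h2 h5 h7 h8; lra.
Qed.

Lemma bump_generator n beta W A c k : 8 <= W -> 0 <= A ->
  0 <= up_rate n beta k -> 0 <= down_rate n beta k -> up_rate n beta k + down_rate n
    beta k <= 1 ->
  (`|k - c| < W -> [/\ 8^-1 <= up_rate n beta k, 8^-1 <= down_rate n beta k &
     `|up_rate n beta k - down_rate n beta k| * W <= A]) ->
  - (128 * (A + 1) ^+ 2 / W ^+ 2) * bump W c k <= generator n beta (bump W c) k.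
Proof.
rewrite /generator; set u := up_rate _ _ _; set d := down_rate _ _ _.
move=> W8 A0 u0 d0 ud near; have W0 : 0 < W by lra.
have [out|inn] := leP W `|k - c|.
  rewrite (bump_out (ltW W0) out) mulr0 !subr0.
  by rewrite addr_ge0 // mulr_ge0 // bump_ge0.
have [u8 d8 DA] := near inn.
have t0 : 0 < W ^+ 2 - (k - c) ^+ 2.
  by rewrite subr_gt0 -[ltLHS]real_normK ?num_real // ltr_pXn2r ?nnegrE // ltW.
have Ep : bump W c (k + 2) = pos_sq (W ^+ 2 - (k - c) ^+ 2 - (4 * (k - c) + 4)).
  by rewrite /bump; congr pos_sq; ring.
have Em : bump W c (k - 2) = pos_sq (W ^+ 2 - (k - c) ^+ 2 + (4 * (k - c) - 4)).
  by rewrite /bump; congr pos_sq; ring.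
have E0 : bump W c k = (W ^+ 2 - (k - c) ^+ 2) ^+ 2 by rewrite /bump pos_sq_pos ?ltW.
rewrite Ep Em E0.
have [small|/ltW big] := leP `|k - c| (W / 2); first exact: bump_center.
have [kc0|/ltW kc0] := leP 0 (k - c).
  by rewrite ger0_norm // in big; exact: bump_edge.
(* Left of the centre, reflect: this exchanges [u] with [d] and [k - c] with its opposite. *)
rewrite ler0_norm // in big.
rewrite [leRHS]addrC (_ : _ - (4 * (k - c) + 4) = W ^+ 2 - (k - c) ^+ 2 + (4 * - (k - c)
  - 4)); last by ring.
rewrite (_ : _ + (4 * (k - c) - 4) = W ^+ 2 - (k - c) ^+ 2 - (4 * - (k - c) + 4));
  last by ring.
apply: bump_edge => //; [by rewrite addrC | by rewrite distrC | by rewrite sqrrN].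
Qed.

End Bumps.

(** * An even test function of mean zero *)

Section TestFunction.
Variable R : realType.
Implicit Types (n : nat) (beta k delta M W : R).

Lemma p_plus_le_three_quarters beta (s : R) : beta * s <= 4^-1 -> p_plus beta s <= 3 / 4.
Proof.
move=> bs; rewrite p_plus_logistic.
have e2 : expR (2 * (beta * s)) <= 2.
  apply: (@le_trans _ _ (expR (2^-1))).
    by rewrite ler_expR; lra.
  by have := @exp_le_linear R 2^-1; lra.
have e0 := expR_gt0 (2 * (beta * s)).
rewrite ler_pdivrMr ?addr_gt0 //; lra.
Qed.

Lemma down_rate_ge n beta k : (0 < n)%N -> 0 <= beta -> 0 <= k -> 4 * (beta * k) <= n%:R
  ->
  8^-1 <= down_rate n beta k.
Proof.
move=> n0 b0 k0 kn; have N0 : 0 < n%:R :> R by rewrite ltr0n.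
have h1 : 4^-1 <= 1 - p_plus beta ((k - 1) / n%:R).
  have : p_plus beta ((k - 1) / n%:R) <= 3 / 4.
    apply: p_plus_le_three_quarters; rewrite mulrA ler_pdivrMr //.
    have : beta * (k - 1) <= beta * k by rewrite ler_wpM2l //; lra.
    lra.
  lra.
have h2 : 2^-1 <= (n%:R + k) / (2 * n%:R) by rewrite ler_pdivlMr ?mulr_gt0 //; lra.
rewrite (_ : 8^-1 = 2^-1 * 4^-1); last by field.
by apply: ler_pM => //; lra.
Qed.

Lemma central_rates n beta W A k : (0 < n)%N -> 0 <= beta -> 8 * W <= n%:R ->
  4 * (beta * (4 * W)) <= n%:R ->
  (forall t, 0 <= t -> t <= 4 * W -> `|up_rate n beta t - down_rate n beta t| * W <= A) ->
  `|k| <= 4 * W ->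
  [/\ 8^-1 <= up_rate n beta k, 8^-1 <= down_rate n beta k &
      `|up_rate n beta k - down_rate n beta k| * W <= A].
Proof.
move=> n0 b0 W8 bW dr kW.
have pos t : 0 <= t -> t <= 4 * W -> 8^-1 <= up_rate n beta t /\ 8^-1 <= down_rate n
  beta t.
  move=> t0 tW; split; first by apply: up_rate_ge => //; lra.
  apply: down_rate_ge => //; apply: le_trans bW.
  by rewrite ler_pM2l // ler_wpM2l.
have [k0|/ltW k0] := leP 0 k.
  rewrite ger0_norm // in kW; have [h1 h2] := pos k k0 kW.
  by split=> //; exact: dr.
rewrite ler0_norm // in kW; have kN : 0 <= - k by rewrite oppr_ge0.
have [h1 h2] := pos _ kN kW; have := dr _ kN kW.
rewrite -[down_rate n beta (- k)]up_rateN opprK up_rateN distrC.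
by rewrite up_rateN in h1; rewrite -up_rateN opprK in h2.
Qed.

(** The coefficients are the weighted sums of the other bump, with opposite signs. All cross terms
    vanish, since the supports stay disjoint after one step, so the two subsolution bounds add
    up. *)
Lemma rayleigh_two_bumps n beta (B1 B2 : config n -> R) (rho : R) x1 x2 : (0 < n)%N ->
  (forall x, 0 <= B1 x) -> (forall x, 0 <= B2 x) -> 0 < B1 x1 -> 0 < B2 x2 ->
  (forall x, B1 x * B2 x = 0) ->
  (forall x, B1 x * glauber_op beta B2 x = 0) -> (forall x, B2 x * glauber_op beta B1 x
    = 0) ->
  (forall x, rho * B1 x <= glauber_op beta B1 x) -> (forall x, rho * B2 x <= glauber_op
    beta B2 x) ->
  exists a b, let F := fun x => a * B1 x + b * B2 x in
    [/\ F x1 != 0, \sum_x gibbs_weight beta x * F x = 0 &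
     rho * \sum_x gibbs_weight beta x * F x ^+ 2
       <= \sum_x gibbs_weight beta x * F x * glauber_op beta F x].
Proof.
move=> n0 B10 B20 B1x B2x B12 B1G B2G sub1 sub2.
pose S (B : config n -> R) := \sum_x gibbs_weight beta x * B x.
have Spos (B : config n -> R) x : (forall x, 0 <= B x) -> 0 < B x -> 0 < S B.
  move=> Bp Bx; rewrite /S (bigD1 x) //=; apply: ltr_pwDl.
    by rewrite mulr_gt0 ?gibbs_weight_gt0.
  by apply: sumr_ge0 => y _; rewrite mulr_ge0 // ltW ?gibbs_weight_gt0.
exists (S B2), (- S B1) => F; split.
- have B2x1 : B2 x1 = 0.
    by have /eqP := B12 x1; rewrite mulf_eq0 gt_eqF //= => /eqP.
  by rewrite /F B2x1 mulr0 addr0 mulf_neq0 // gt_eqF // (Spos _ x2).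
- rewrite /F; under eq_bigr do rewrite mulrDr mulrCA [X in _ + X]mulrCA.
  by rewrite big_split /= -!mulr_sumr -/(S B1) -/(S B2) mulrC mulNr subrr.
rewrite mulr_sumr; apply: ler_sum => x _;
  rewrite mulrCA -mulrA ler_pM2l ?gibbs_weight_gt0 //.
rewrite /F glauber_opD !glauber_opZ.
set a := S B2; set b := - S B1; set g1 := glauber_op _ _ _; set g2 := glauber_op _ _ _.
have h1 : a ^+ 2 * (B1 x * (rho * B1 x)) <= a ^+ 2 * (B1 x * g1).
  by rewrite ler_wpM2l ?sqr_ge0 // ler_wpM2l // sub1.
have h2 : b ^+ 2 * (B2 x * (rho * B2 x)) <= b ^+ 2 * (B2 x * g2).
  by rewrite ler_wpM2l ?sqr_ge0 // ler_wpM2l // sub2.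
rewrite [leLHS](_ : _ = a ^+ 2 * (B1 x * (rho * B1 x)) + b ^+ 2 * (B2 x * (rho * B2 x))
  + 2 * rho * a * b * (B1 x * B2 x)); last by ring.
rewrite [leRHS](_ : _ = a ^+ 2 * (B1 x * g1) + b ^+ 2 * (B2 x * g2) + a * b * (B1 x *
  g2) + a * b * (B2 x * g1)); last by ring.
by rewrite B12 B1G B2G !mulr0 !addr0 lerD.
Qed.

Lemma bumps_test_function n beta W A : (0 < n)%N -> 0 <= beta -> 8 <= W -> 0 <= A ->
  8 * W <= n%:R -> 4 * (beta * (4 * W)) <= n%:R ->
  (forall t, 0 <= t -> t <= 4 * W -> `|up_rate n beta t - down_rate n beta t| * W <= A) ->
  exists F x0, [/\ @even_fun R n F, F x0 != 0, \sum_x gibbs_weight beta x * F x = 0 &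
    (1 - 128 * (A + 1) ^+ 2 / W ^+ 2) * \sum_x gibbs_weight beta x * F x ^+ 2
       <= \sum_x gibbs_weight beta x * F x * glauber_op beta F x].
Proof.
move=> n0 b0 W8 A0 Wn bW dr; have W0 : 0 < W by lra.
set eps := 128 * _ / _.
pose K (x : config n) : R := (total_spin x)%:~R.
have Kn x : `|K x| <= n%:R.
  by rewrite /K -intr_norm -[n%:R]/((n%:Z)%:~R) ler_int; exact: total_spin_bound.
have up0 x : 0 <= up_rate n beta (K x).
  by apply: up_rate_ge0 => //; exact: le_trans (ler_norm _) (Kn x).
have down0 x : 0 <= down_rate n beta (K x).
  by apply: down_rate_ge0 => //; have := Kn x; rewrite ler_norml => /andP[].
have gen c x : `|c| <= 3 * W -> - eps * bump W c (K x) <= generator n beta (bump W c) (K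
  x).
  move=> cW; apply: bump_generator => //.
    by apply: rates_le1 => //; have := Kn x; rewrite ler_norml => /andP[].
  move=> near; apply: central_rates => //.
  have := ler_normD (K x - c) c; rewrite subrK; lra.
(* The pair of outer bumps is even, and at distance [W >= 8] from the central one, farther than a
   jump of 2. *)
pose psi2 k := bump W (3 * W) k + bump W (- (3 * W)) k.
pose B1 x := bump W 0 (K x); pose B2 x := psi2 (K x).
have genD k : generator n beta psi2 k = generator n beta (bump W (3 * W)) k + generator
  n beta (bump W (- (3 * W))) k.
  by rewrite /generator /psi2; ring.
have far0 c k : `|k| <= W + 2 -> `|c| = 3 * W -> bump W c k = 0.
  move=> kW cW; apply: bump_out; first exact: ltW.
  have := ler_normD (c - k) k; rewrite subrK cW distrC; lra.
have psi2far k : `|k| <= W + 2 -> psi2 k = 0.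
  by move=> kW; rewrite /psi2 !far0 ?addr0 ?normrN // ger0_norm // mulr_ge0 // ltW.
have psi1far k : W <= `|k| -> bump W 0 k = 0.
  by move=> kW; apply: bump_out; rewrite ?subr0 // ltW.
have step2 k e : `|e| = 2 -> `|k + e| <= `|k| + 2 by move=> <-; exact: ler_normD.
have n2 : `|2| = 2 :> R by rewrite ger0_norm.
have nn2 : `|-2| = 2 :> R by rewrite normrN.
have [|c1 [x1 [x1E c1l c1r]]] := @lattice_point R n 0 (lexx 0); first by rewrite ler0n.
have [||c2 [x2 [x2E c2l c2r]]] := @lattice_point R n (3 * W); [by lra | by lra |].
have B1x : 0 < B1 x1.
  by apply: bump_in; rewrite /K x1E subr0 ltr_norml; apply/andP; split; lra.
have B2x : 0 < B2 x2.
  rewrite /B2 /psi2; apply: ltr_pwDl; last exact: bump_ge0.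
  by apply: bump_in; rewrite /K x2E ltr_norml; apply/andP; split; lra.
have inner x : B1 x != 0 -> `|K x| < W.
  by rewrite ltNge; apply: contraNN => kW; rewrite /B1 psi1far.
have GB1 x : glauber_op beta B1 x = B1 x + generator n beta (bump W 0) (K x).
  exact: glauber_op_total_spin.
have GB2 x : glauber_op beta B2 x = B2 x + generator n beta psi2 (K x).
  exact: glauber_op_total_spin.
have B1far x : B2 x != 0 -> W + 2 < `|K x|.
  by rewrite ltNge; apply: contraNN => kW; rewrite /B2 psi2far.
have [|||||||a [b /= [F0 mean ray]]] := @rayleigh_two_bumps n beta B1 B2 (1 - eps) x1 x2
  n0 _ _ B1x B2x.
- by move=> x; exact: bump_ge0.
- by move=> x; rewrite addr_ge0 ?bump_ge0.
- move=> x; have [->|/inner kW] := eqVneq (B1 x) 0; first by rewrite mul0r.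
  by rewrite /B2 psi2far ?mulr0 //; lra.
- move=> x; have [->|/inner kW] := eqVneq (B1 x) 0; first by rewrite mul0r.
  rewrite GB2 /B2 /generator !psi2far ?subrr ?mulr0 ?addr0 ?mulr0 //; try lra.
    by have := step2 (K x) (-2) nn2; lra.
  by have := step2 (K x) 2 n2; lra.
- move=> x; have [->|/B1far kW] := eqVneq (B2 x) 0; first by rewrite mul0r.
  rewrite GB1 /B1 /generator !psi1far ?subrr ?mulr0 ?addr0 ?mulr0 //; try lra.
    by have := step2 (K x - 2) 2 n2; rewrite subrK; lra.
  by have := step2 (K x + 2) (-2) nn2; rewrite addrK; lra.
- move=> x; rewrite GB1; have : `|0 : R| <= 3 * W by rewrite normr0 mulr_ge0 // ltW.
  by move=> /(gen 0 x); rewrite -/(B1 x); lra.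
- move=> x; rewrite GB2 genD.
  have h1 : `|3 * W| <= 3 * W by rewrite ger0_norm // mulr_ge0 // ltW.
  have h2 : `|- (3 * W)| <= 3 * W by rewrite normrN.
  have := gen _ x h1; have := gen _ x h2; rewrite /B2 /psi2; lra.
exists (fun x => a * B1 x + b * B2 x), x1; split=> //.
move=> x; rewrite /B1 /B2 /psi2 /K total_spin_flip rmorphN /= !bumpN oppr0 opprK.
by congr (_ + _ * _); rewrite addrC.
Qed.

Lemma even_test_function M : 0 < M -> exists C T : R, 0 < C /\
  forall n delta, 0 < delta -> delta <= M ->
  T <= delta * n%:R -> T <= delta ^+ 2 * n%:R ->
  exists F x0, [/\ @even_fun R n F, F x0 != 0,
    \sum_x gibbs_weight (1 + delta) x * F x = 0 &
    (1 - C * (delta / n%:R)) * \sum_x gibbs_weight (1 + delta) x * F x ^+ 2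
       <= \sum_x gibbs_weight (1 + delta) x * F x * glauber_op (1 + delta) F x].
Proof.
move=> M0; have [gamma [kap [ga0 ga1 kap0 prof]]] := bias_profile M0.
have M1 : 0 < 1 + M by lra.
have MM : 0 < (1 + M) ^+ 2 by rewrite exprn_gt0.
have k4 : 0 < (4 / kap) ^+ 2 by rewrite exprn_gt0 // divr_gt0.
exists (128 * (4 + 1) ^+ 2), (256 * (1 + M) ^+ 2 + (4 / kap) ^+ 2).
split; first by rewrite mulr_gt0 // exprn_gt0.
move=> n delta d0 dM T1 T2.
have dn : 256 * (1 + M) ^+ 2 <= delta * n%:R by lra.
have kn : (4 / kap) ^+ 2 <= delta ^+ 2 * n%:R by lra.
have dn32 : 32 * (1 + M) ^+ 2 <= delta * n%:R by lra.
clear T1 T2 k4.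
have [n0 nM q1 q2 qd] := field_factor_bounds M0 d0 dM dn32.
have N0 : 0 < n%:R :> R by rewrite ltr0n.
have [sc [sckap sc1 scL _]] := prof delta _ d0 dM q1 q2 qd.
have b0 : 0 <= 1 + delta by rewrite addr_ge0 // ltW.
pose W := Num.sqrt (n%:R / delta).
have W0 : 0 < W by rewrite sqrtr_gt0 divr_gt0.
have W2 : W ^+ 2 = n%:R / delta by rewrite sqr_sqrtr // divr_ge0 // ltW.
have n256 : 256 * (1 + M) <= n%:R.
  have h : delta * n%:R <= (1 + M) * n%:R by rewrite ler_pM2r //; clear -dM; lra.
  rewrite -(ler_pM2l M1) (le_trans _ h) // (le_trans _ dn) // expr2; clear; lra.
have W8 : 8 <= W.
  rewrite -(ler_pXn2r (isT : (0 < 2)%N)) ?nnegrE ?(ltW W0) // W2 ler_pdivlMr //.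
  clear -n256 dM M0 d0; lra.
have Wn : 16 * ((1 + M) * W) <= n%:R.
  rewrite -(ler_pXn2r (isT : (0 < 2)%N)) ?nnegrE ?mulr_ge0 ?(ltW W0) ?(ltW M1) //.
  rewrite !exprMn W2 (_ : _ * _ = 256 * (1 + M) ^+ 2 / delta * n%:R); last by field;
    rewrite gt_eqF.
  by rewrite [n%:R ^+ 2]expr2 ler_pM2r // ler_pdivrMr // [leRHS]mulrC.
have WM : 1 * W <= (1 + M) * W by rewrite ler_pM2r //; clear -M0; lra.
have bW : (1 + delta) * W <= (1 + M) * W by rewrite ler_pM2r //; clear -dM; lra.
(* This is where [delta^2 * n] must be large: the bumps have to fit before the stable zero, which is
   at least of order [n * sqrt delta]. *)
have Wsc : 4 * W <= n%:R * sc.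
  have h : 4 * W <= n%:R * (kap * Num.sqrt delta).
    rewrite -(ler_pXn2r (isT : (0 < 2)%N)) ?nnegrE ?mulr_ge0 ?sqrtr_ge0 ?(ltW W0) ?(ltW
      kap0) //.
    rewrite !exprMn W2 sqr_sqrtr ?(ltW d0) //.
    rewrite expr_div_n ler_pdivrMr ?exprn_gt0 // in kn.
    have h2 := ler_wpM2r (ltW (divr_gt0 N0 d0)) kn.
    apply: (le_trans h2); rewrite le_eqVlt; apply/orP; left; apply/eqP.
    by field; rewrite gt_eqF.
  by apply: (le_trans h); rewrite ler_pM2l.
(* [A = 4] because the drift at [t <= 4 W] is at most [delta * t / n], and
   [4 W * W * delta / n = 4]. *)
have := @bumps_test_function n (1 + delta) W 4 n0 b0 W8 (ler0n _ 4).
have -> : 128 * (4 + 1) ^+ 2 / W ^+ 2 = 128 * (4 + 1) ^+ 2 * (delta / n%:R).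
  by rewrite W2 invf_div.
apply.
- clear -Wn WM W0; lra.
- clear -Wn bW; lra.
move=> t t0 tW; have [h /andP[h1 h2] ->] := drift_bias t n0 b0.
have s0 : 0 <= t / n%:R by rewrite divr_ge0 // ltW.
have ssc : t / n%:R <= sc by rewrite ler_pdivrMr // mulrC (le_trans tW).
have bge : 0 <= bias (1 + delta) (expR (2 * ((1 + delta) / n%:R))) (t / n%:R).
  apply: le_trans (scL _ s0 ssc); rewrite mulr_ge0 ?mulr_ge0 ?(ltW ga0) ?(ltW d0) //.
  by rewrite le_min s0 subr_ge0.
have ble : bias (1 + delta) (expR (2 * ((1 + delta) / n%:R))) (t / n%:R) <= delta * (t /
  n%:R).
  have := bias_le M0 d0 dM q1 s0 (le_trans ssc sc1) => hb; apply: (le_trans hb).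
  by rewrite ler_wpM2r // gerBl divr_ge0 ?sqr_ge0.
rewrite ger0_norm; last by rewrite mulr_ge0 //; clear -h1; lra.
have h0 : 0 <= h by clear -h1; lra.
have : h * bias (1 + delta) (expR (2 * ((1 + delta) / n%:R))) (t / n%:R) <= 1 * (delta *
  (t / n%:R)).
  by apply: ler_pM.
move=> /(ler_wpM2r (ltW W0)) hh; apply: (le_trans hh); rewrite mul1r.
have tWW : t * W <= 4 * W * W by rewrite ler_pM2r.
rewrite (_ : _ * W = delta / n%:R * (t * W)); last by field; rewrite gt_eqF.
apply: (@le_trans _ _ (delta / n%:R * (4 * W * W))).
  by rewrite ler_pM2l // divr_gt0.
rewrite (_ : 4 * W * W = 4 * W ^+ 2); last by ring.
rewrite W2 le_eqVlt; apply/orP; left; apply/eqP.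
by field; rewrite !gt_eqF.
Qed.

End TestFunction.

(** * Two-sided bounds on the spectral gap *)

Section SpectralGap.
Variable R : realType.
Implicit Types (n : nat) (delta M : R).

(** The eigenvalue from the Rayleigh quotient could be the trivial one. In that case subtracting the
    mean from [g] gives an even mean-zero function with eigenvalue 1, excluded by the last
    hypothesis; it is nonzero because a constant [g] would be orthogonal to [F]. *)
Lemma nontrivial_even_eigenvalue n (beta rho : R) F x0 : (0 < n)%N ->
  @even_fun R n F -> F x0 != 0 -> \sum_x gibbs_weight beta x * F x = 0 ->
  rho * \sum_x gibbs_weight beta x * F x ^+ 2
    <= \sum_x gibbs_weight beta x * F x * glauber_op beta F x ->
  (forall (g : config n -> R) lam y0, even_fun g -> \sum_x gibbs_weight beta x * g x = 0
    ->
    (forall x, glauber_op beta g x = lam * g x) -> g y0 != 0 -> lam < 1) ->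
  exists2 lam : R, rho <= lam &
    eigenvalue (kernel_matrix (@censored_glauber R n beta)) lam%:C%C /\ lam%:C%C != 1.
Proof.
move=> n0 eF F0 mF ray gap.
have [lam [g [rl eg Gg Fg]]] := glauber_rayleigh eF F0 ray.
exists lam => //; have [y0 gy0] : exists y0, g y0 != 0.
  apply/existsP; apply: contraNT Fg; rewrite negb_exists => /forallP z.
  by apply/eqP; apply: big1 => x _; have := z x; rewrite negbK => /eqP ->; rewrite mulr0.
split; first exact: (even_eigen_censored eg gy0 Gg).
apply/eqP => /(congr1 (@complex.Re R)) /= lam1.
pose w0 : R := \sum_(x : config n) gibbs_weight beta x.
have w0gt : 0 < w0.
  rewrite /w0 (bigD1 x0) //=; apply: ltr_pwDl; first exact: gibbs_weight_gt0.
  by apply: sumr_ge0 => x _; rewrite ltW ?gibbs_weight_gt0.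
pose m := (\sum_x gibbs_weight beta x * g x) / w0.
pose h x := g x + -1 * m.
have [z hz] : exists z, h z != 0.
  apply/existsP; apply: contraNT Fg; rewrite negb_exists => /forallP z.
  have gm x : g x = m by have := z x; rewrite negbK /h mulN1r subr_eq0 => /eqP.
  by under eq_bigr do rewrite gm; rewrite -mulr_suml mF mul0r.
have : 1 < 1 :> R; last by rewrite ltxx.
apply: (gap h 1 z) => //.
- by move=> x; rewrite /h eg.
- rewrite /h; under eq_bigr do rewrite mulrDr; rewrite big_split /= -mulr_suml -/w0 /m.
  by rewrite mulN1r mulrN mulrC divfK ?gt_eqF // subrr.
- by move=> x; rewrite /h glauber_opD glauber_opZ glauber_op_cst // Gg lam1 !mul1r.
Qed.

Lemma spectral_gap_bounds (T : finType) (P : T -> T -> R) (a b lam : R) :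
  (forall z : R[i], eigenvalue (kernel_matrix P) z -> z != 1 ->
     exists2 r : R, z = r%:C%C & 0 <= r <= 1 - a) ->
  eigenvalue (kernel_matrix P) lam%:C%C -> lam%:C%C != 1 -> 1 - b <= lam ->
  a <= spectral_gap P <= b.
Proof.
move=> small lamE lam1 lamb; rewrite /spectral_gap; set S := [set _ | _ in _].
have ReE (r : R) : 0 <= r -> complex.Re `|r%:C%C| = r.
  by move=> r0; rewrite ger0_norm // lecR.
have ub : ubound S (1 - a).
  move=> _ [z [zE z1] <-]; have [r -> /andP[r0 ra]] := small z zE z1.
  by rewrite ReE.
have Slam : S lam.
  have [r /(congr1 (@complex.Re R)) /= lr /andP[r0 _]] := small _ lamE lam1.
  by exists lam%:C%C => //; rewrite ReE // lr.
have sup1 : sup S <= 1 - a by apply: ge_sup => //; exists lam.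
have sup2 : lam <= sup S by apply: ub_le_sup => //; exists (1 - a).
by apply/andP; split; lra.
Qed.

Lemma censored_spectral_gap_bounds M : 0 < M -> exists a b T : R, [/\ 0 < a, 0 < b &
  forall n delta, 0 < delta -> delta <= M -> T <= delta ^+ 2 * n%:R ->
  a * (delta / n%:R) <= spectral_gap (@censored_glauber R n (1 + delta)) <= b * (delta /
    n%:R)].
Proof.
move=> M0; have [e0 [T1 [e00 low]]] := even_eigenvalue_bound M0.
have [C [T2 [C0 test]]] := even_test_function M0.
have M1 : 0 < 1 + M by lra.
pose T := Num.max 1 (Num.max T1 T2).
have T1le : 1 <= T by rewrite le_max lexx.
have TT1 : T1 <= T by rewrite !le_max lexx orbT.
have TT2 : T2 <= T by rewrite !le_max lexx !orbT.
(* The second term of the minimum covers eigenvalues up to 1/2, since [delta / n <= 1 + M]. The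
   factor [(1 + M)^2] turns the bound on [delta^2 * n] into bounds on [delta * n] and
   [n * sqrt delta]. *)
exists (Num.min e0 (2^-1 / (1 + M))), C, (T * (1 + M) ^+ 2); split=> //.
  by rewrite lt_min e00 divr_gt0.
move=> n delta d0 dM Tdn.
have MM : 1 <= 1 + M by lra.
have T0 : 0 < T by lra.
have dM1 : delta <= 1 + M by lra.
have N0 : 0 < n%:R :> R.
  rewrite lt0r ler0n andbT; apply: contraTneq Tdn => ->.
  by rewrite mulr0 -ltNge mulr_gt0 // exprn_gt0.
have n0 : (0 < n)%N by rewrite -(ltr0n R).
have N1 : 1 <= n%:R :> R by rewrite ler1n.
have h1 : T * (1 + M) <= delta * n%:R.
  rewrite -(ler_pM2l M1); apply: (@le_trans _ _ (delta ^+ 2 * n%:R)).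
    by apply: le_trans Tdn; rewrite expr2; lra.
  by rewrite expr2 -mulrA; apply: ler_wpM2r => //; rewrite mulr_ge0 // ltW.
have h1' : T <= delta * n%:R by apply: le_trans h1; rewrite ler_peMr // ltW.
have h2 : T <= delta ^+ 2 * n%:R.
  by apply: le_trans Tdn; rewrite ler_peMr ?exprn_ege1 // ltW.
have sd0 : 0 < Num.sqrt delta by rewrite sqrtr_gt0.
have sdE : Num.sqrt delta * Num.sqrt delta = delta by rewrite -expr2 sqr_sqrtr // ltW.
have sdM : Num.sqrt delta <= 1 + M.
  rewrite -(ler_pXn2r (isT : (0 < 2)%N)) ?nnegrE ?(ltW sd0) ?(ltW M1) //.
  by rewrite [leLHS]expr2 sdE (le_trans dM1) // expr2 ler_peMr // ltW.
have h3 : T <= n%:R * Num.sqrt delta.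
  rewrite -(ler_pM2l M1) [leLHS]mulrC; apply: (le_trans h1).
  rewrite [leLHS](_ : _ = Num.sqrt delta * (n%:R * Num.sqrt delta));
    last by rewrite -[in LHS]sdE; ring.
  by apply: ler_wpM2r => //; rewrite mulr_ge0 // ltW.
have dn0 : 0 < delta / n%:R by rewrite divr_gt0.
have bound (g : config n -> R) lam y0 : even_fun g ->
    \sum_x gibbs_weight (1 + delta) x * g x = 0 ->
    (forall x, glauber_op (1 + delta) g x = lam * g x) -> g y0 != 0 ->
    lam <= 1 - e0 * (delta / n%:R).
  by apply: low => //; [exact: le_trans h1' | exact: le_trans h3].
have e0dn : 0 < e0 * (delta / n%:R) by rewrite mulr_gt0.
have [F [x0 [eF F0 mF ray]]] := test n delta d0 dM (le_trans TT2 h1') (le_trans TT2 h2).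
have b0 : 0 <= 1 + delta by lra.
have [|lam lamge [lamE lam1]] := nontrivial_even_eigenvalue n0 eF F0 mF ray.
  by move=> g lam y0 eg mg Gg gy; have := bound g lam y0 eg mg Gg gy; lra.
apply: (spectral_gap_bounds _ lamE lam1 lamge) => z zE z1.
have [r zr [r0 cases]] := censored_eigen n0 b0 zE.
exists r => //; rewrite r0 /=.
case: cases => [rh|[g [eg [y0 gy0] Gg]]].
  have : Num.min e0 (2^-1 / (1 + M)) * (delta / n%:R) <= 2^-1 / (1 + M) * (1 + M).
    apply: ler_pM; rewrite ?le_min ?ge_min ?lexx ?orbT ?(ltW e00) ?divr_ge0 ?(ltW M1)
      ?(ltW d0) //.
    by rewrite ler_pdivrMr // (le_trans dM1) // ler_peMr // ltW.
  by rewrite divfK ?gt_eqF //; lra.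
have r1 : r != 1 by apply: contraNneq z1 => r1; rewrite zr r1.
have := bound g r y0 eg (eigen_mean0 n0 r1 Gg) Gg gy0.
have : Num.min e0 (2^-1 / (1 + M)) * (delta / n%:R) <= e0 * (delta / n%:R).
  by rewrite ler_pM2r // ge_min lexx.
lra.
Qed.

End SpectralGap.

Theorem theorem2 (R : realType) (delta : nat -> R)
  (delta_gt0 : forall n, 0 < delta n)
  (delta_bounded : exists M : R, forall n, delta n <= M)
  (delta_window : (fun n => delta n ^+ 2 * n%:R) @ \oo --> +oo) :
  (fun n => spectral_gap (@censored_glauber R n (1 + delta n)))
    \is 'Theta_\oo (fun n => delta n / n%:R).
Proof.
have [M bM] := delta_bounded.
have M0 : 0 < M := lt_le_trans (delta_gt0 0%N) (bM 0%N).
have [a [b [T [a0 b0 gap]]]] := @censored_spectral_gap_bounds R M M0.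
rewrite qualifE; apply/asboolP; exists (a, b) => /=; first by rewrite a0.
have /cvgryPge/(_ T) Tn := delta_window.
near=> n; have /andP[g1 g2] : a * (delta n / n%:R)
    <= spectral_gap (@censored_glauber R n (1 + delta n)) <= b * (delta n / n%:R).
  by apply: gap => //; near: n.
have dn : 0 <= delta n / n%:R by rewrite divr_ge0 // ltW.
rewrite (ger0_norm dn) ger0_norm //.
by apply: le_trans g1; rewrite mulr_ge0 // ltW.
Unshelve. all: by end_near. Qed.
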